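(* Let $U\subset\mathbb{R}^m$ be nonempty and compact, let $\mathcal{C}\subset\mathbb{R}^n$ be nonempty and closed with compact boundary, and let $f:\mathbb{R}^n\times U\to\mathbb{R}^n$ and $l:\mathbb{R}^n\times U\to[0,+\infty)$ be continuous and such that $x\mapsto f(x,u)$ and $x\mapsto l(x,u)$ are locally Lipschitz continuous, uniformly with respect to $u\in U$. Let $W:\overline{\mathbb{R}^n\setminus\mathcal{C}}\to[0,+\infty)$ be a continuous Minimum Restraint function for the system $\dot x=f(x,u)$ with cost $\int l(x,u)\,dt$, for some continuous and increasing function $p_0:(0,+\infty)\to[0,1]$ and some continuous and strictly increasing function $\gamma:(0,+\infty)\to(0,+\infty)$. Then, for any $z\in\mathbb{R}^n\setminus\mathcal{C}$, $$W(z)\ge\inf_{u\in\mathcal{U}(z)}\ \sup_{0\le T<T_z(u)}\left\{\int_0^T\left[p_0(W(x(t)))\,l(x(t),u(t))+\gamma(W(x(t)))\right]dt+W(x(T))\right\},$$ where $x(\cdot):=x(\cdot,u,z)$.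
   Context: Write $\mathbf{d}(y)$ for the Euclidean distance of $y\in\mathbb{R}^n$ from $\mathcal{C}$. ''Increasing'' means nondecreasing unless ''strictly'' is specified. $\mathcal{M}([0,+\infty),U)$ is the set of Lebesgue measurable functions $[0,+\infty)\to U$. For $z\in\mathbb{R}^n\setminus\mathcal{C}$ and $u\in\mathcal{M}([0,+\infty),U)$, $x(\cdot,u,z)$ denotes the unique maximal solution, on $[0,T^{\max})$ with $T^{\max}\le+\infty$, of $\dot x(t)=f(x(t),u(t))$ a.e., $x(0)=z$. The control $u$ is admissible from $z$ if there exists $0<T_z(u)\le T^{\max}\le+\infty$ such that $x(t,u,z)\notin\mathcal{C}$ for all $t\in[0,T_z(u))$ and, if $T_z(u)<+\infty$, $\lim_{t\to T_z(u)^-}\mathbf{d}(x(t,u,z))=0$. $\mathcal{U}(z)$ is the set of controls admissible from $z$. A continuous function $W:\overline{\mathbb{R}^n\setminus\mathcal{C}}\to[0,+\infty)$ is positive definite if $W>0$ on $\mathbb{R}^n\setminus\mathcal{C}$ and $W=0$ on $\partial\mathcal{C}$; it is proper if $W^{-1}(K)$ is compact for every compact $K\subset[0,+\infty)$. Proximal subdifferential: $p\in\partial_PW(x)$ if and only if there exist $\sigma>0$ and $\eta>0$ such that $W(y)-W(x)+\sigma|y-x|^2\ge\langle p,y-x\rangle$ for all $y$ with $|y-x|\le\eta$ (the set may be empty). A continuous, positive definite, proper $W:\overline{\mathbb{R}^n\setminus\mathcal{C}}\to[0,+\infty)$ is a Minimum Restraint function for $p_0$ and $\gamma$ as in the claim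 if $$\min_{u\in U}\{\langle p,f(x,u)\rangle+p_0(W(x))\,l(x,u)\}\le-\gamma(W(x))\quad\text{for all }x\in\mathbb{R}^n\setminus\mathcal{C},\ p\in\partial_PW(x).$$ *)

(* Defs.v *)
From HB Require Import structures.
From mathcomp Require Import all_boot all_order all_algebra.
From mathcomp Require Import all_classical all_reals all_analysis.

Set Implicit Arguments.
Unset Strict Implicit.
Unset Printing Implicit Defensive.

Import Order.TTheory GRing.Theory Num.Theory.
Import numFieldNormedType.Exports.

Local Open Scope classical_set_scope.
Local Open Scope ring_scope.

Section Euclidean.
Context {R : realType} {n : nat}.
Implicit Types x y : 'rV[R]_n.

(* The norm `|x| that the library puts on 'rV[R]_n is the sup norm. It is
   equivalent to enorm, and is used below only for notions (topology, local
   Lipschitz and absolute continuity, derivatives) that do not depend on the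
   choice between equivalent norms. *)
Definition dotv x y : R := \sum_(i < n) x ord0 i * y ord0 i.
Definition enorm x : R := Num.sqrt (dotv x x).

Definition edistance (C : set 'rV[R]_n) y : R :=
  inf [set enorm (y - c) | c in C].

Definition boundary (C : set 'rV[R]_n) : set 'rV[R]_n := closure C `\` C°.

End Euclidean.

Section Functions.
Context {R : realType}.

Definition is_min (T : Type) (A : set T) (h : T -> R) (v : R) : Prop :=
  (exists2 a, A a & h a = v) /\ (forall a, A a -> v <= h a).

Definition locally_lipschitz_unif (V W : normedModType R) (T : Type)
    (A : set T) (g : V -> T -> W) : Prop :=
  forall x0 : V, exists k : R, exists2 B : set V, nbhs x0 B &
    forall a, A a -> k.-lipschitz_B (g ^~ a).

Definition absolutely_continuous (V : normedModType R) (a b : R)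
    (x : R -> V) : Prop :=
  forall e : R, 0 < e -> exists2 d : R, 0 < d &
    forall (k : nat) (s t : 'I_k -> R),
      (forall i, a <= s i /\ s i <= t i /\ t i <= b) ->
      trivIset [set: 'I_k] (fun i => `]s i, t i[%classic) ->
      \sum_(i < k) (t i - s i) < d ->
      \sum_(i < k) `|x (t i) - x (s i)| < e.

End Functions.

(* Lebesgue measure on the (complete) Lebesgue sigma-algebra, not only on the
   Borel one. *)
Notation leb := completed_lebesgue_measure.

(* R with the Lebesgue sigma-algebra, the domain of leb. *)
Notation lebesgueType R :=
  (caratheodory_type (mu_ext (wlength (R := R) idfun))).

Section ControlSystem.
Context {R : realType} {n m : nat}.
Implicit Types (C : set 'rV[R]_n) (U : set 'rV[R]_m).
Implicit Types (f : 'rV[R]_n -> 'rV[R]_m -> 'rV[R]_n).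
Implicit Types (u : R -> 'rV[R]_m) (z : 'rV[R]_n) (x : R -> 'rV[R]_n).

(* Lebesgue measurable functions [0, +oo) -> U; R^m carries its Borel
   sigma-algebra. The values of u at negative times are irrelevant. *)
Definition control U u : Prop :=
  (forall t : R, 0 <= t -> U (u t)) /\
  measurable_fun (`[0, +oo[%classic : set (lebesgueType R))
    (u : lebesgueType R -> g_sigma_algebraType (@open 'rV[R]_m)).

(* Caratheodory solutions on [0, T), where T may be +oo; the values of x
   outside [0, T) are irrelevant. *)
Definition solution f u z x (T : \bar R) : Prop :=
  [/\ (0 < T)%E,
      x 0 = z,
      forall b : R, 0 <= b -> (b%:E < T)%E -> absolutely_continuous 0 b x &
      {ae @leb R, forall t : R, 0 < t -> (t%:E < T)%E ->
         is_derive t 1 x (f (x t) (u t))} ].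

Definition maximal_solution f u z x (Tmax : \bar R) : Prop :=
  solution f u z x Tmax /\
  forall y (T : \bar R), solution f u z y T -> (Tmax <= T)%E ->
    (forall t : R, 0 <= t -> (t%:E < Tmax)%E -> y t = x t) -> T = Tmax.

(* u is admissible from z, with trajectory x = x(., u, z) and T = T_z(u).
   Under the hypotheses of the theorem x is determined on [0, T) by u and z,
   and so is T. *)
Definition admissible C U f z u x (T : \bar R) : Prop :=
  control U u /\
  exists2 Tmax : \bar R, maximal_solution f u z x Tmax &
    [/\ (0 < T)%E, (T <= Tmax)%E,
        forall t : R, 0 <= t -> (t%:E < T)%E -> ~ C (x t) &
        forall tau : R, T = tau%:E ->
          edistance C (x t) @[t --> tau^'-] --> (0 : R) ].

End ControlSystem.

Section MinimumRestraint.
Context {R : realType} {n m : nat}.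
Implicit Types (C : set 'rV[R]_n) (U : set 'rV[R]_m).
Implicit Types (f : 'rV[R]_n -> 'rV[R]_m -> 'rV[R]_n).
Implicit Types (l : 'rV[R]_n -> 'rV[R]_m -> R) (W : 'rV[R]_n -> R).

(* D is the domain of W. *)
Definition proximal_subdifferential (D : set 'rV[R]_n) W (x : 'rV[R]_n) :
    set 'rV[R]_n :=
  [set p | exists sigma eta : R, [/\ 0 < sigma, 0 < eta &
     forall y, D y -> enorm (y - x) <= eta ->
       dotv p (y - x) <= W y - W x + sigma * enorm (y - x) ^+ 2]].

Definition positive_definite C W : Prop :=
  (forall x, ~ C x -> 0 < W x) /\ (forall x, boundary C x -> W x = 0).

Definition proper_on_domain C W : Prop :=
  forall K : set R, compact K -> K `<=` `[0, +oo[ ->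
    compact (closure (~` C) `&` W @^-1` K).

(* W, p0 and gamma are total functions whose values matter only on
   closure (~` C), on ]0, +oo[ and on ]0, +oo[ respectively. *)
Definition minimum_restraint_function C U f l (p0 gamma : R -> R) W : Prop :=
  [/\ (forall x, closure (~` C) x -> 0 <= W x),
      {within closure (~` C), continuous W},
      positive_definite C W,
      proper_on_domain C W &
      forall x p, ~ C x ->
        proximal_subdifferential (closure (~` C)) W x p ->
        exists2 v : R,
          is_min U (fun u => dotv p (f x u) + p0 (W x) * l x u) v &
          v <= - gamma (W x)].

(* The bracket of the theorem at time T. *)
Definition running_value l (p0 gamma : R -> R) W
    (x : R -> 'rV[R]_n) (u : R -> 'rV[R]_m) (T : R) : \bar R :=
  (\int[leb]_(t in `[0%R, T]%classic)
     (p0 (W (x t)) * l (x t) (u t) + gamma (W (x t)))%:E + (W (x T))%:E)%E.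

End MinimumRestraint.

(* Main.v *)
(** W is regularized by V(x) = min_y W(y) + kappa |x - y|^2. If y attains the
    minimum, then p = 2 kappa (x - y) is a proximal subgradient of W at y, so the
    Minimum Restraint inequality at (y, p) provides a control value u. Running
    the ODE from x with the constant control u for a short time h then decreases
    V at the rate p0(W) l + gamma(W), up to an error that is small relative to
    gamma on the band {w/2 < W <= 2w}; V itself is within th * w of W there. In
    each band kappa and h are fixed. When W has been halved, a new band with a
    smaller w is entered, and the errors sum to a geometric series. The pieces
    are glued into one trajectory with piecewise constant control. If their
    total length is finite, infinitely many bands are visited, so W, hence the
    distance to C, tends to 0. *)
Require Import Defs.
From HB Require Import structures.
From mathcomp Require Import all_boot all_order all_algebra.
From mathcomp Require Import all_classical all_reals all_analysis.
From mathcomp Require Import measurable_realfun.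
From mathcomp Require Import ring lra.

Import Order.TTheory GRing.Theory Num.Theory.
Import numFieldNormedType.Exports.

Set Implicit Arguments.
Unset Strict Implicit.
Unset Printing Implicit Defensive.

Local Open Scope classical_set_scope.
Local Open Scope ring_scope.

(** * Inner product, sup norm and derivatives of row vectors *)

Section RowVectors.
Context {R : realType} {n : nat}.
Implicit Types (x y p v : 'rV[R]_n) (phi : R -> 'rV[R]_n) (t : R).

(** [W] is merely continuous, so [kappa * |x - y|] need not stay bounded as kappa grows, and moving
    the Minimum Restraint inequality from [y] to [x] looks hopeless. The Lipschitz estimate for [f]
    rescues it: the error is of order [kappa * |x - y|^2], and minimality of [y] gives
    [kappa * |x - y|^2 <= W x - W y], which uniform continuity makes small. This dictates the order
    of choice: a tolerance for [W], a radius, kappa from the radius, and [h] last, to absorb the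
    terms of order [kappa * h]. Since [l] may vanish, the rate is bounded below only by gamma, which
    may tend to 0 with [W]; hence the bands. Inside a band the comparison is multiplicative: the
    cost of a piece is at most [1 + th] times the drop of [V], so it telescopes over any number of
    pieces. Additive errors of size [th * w] arise only in passing between [V] and [W], at a change
    of band or at the final time. Admissibility refers to a maximal solution, while the pieces
    define one only up to their total length; Zorn's lemma supplies the extension. *)

Lemma normr_coord_le x i : `|x ord0 i| <= `|x|.
Proof.
by rewrite [leRHS]/Num.Def.normr/= mx_normrE (le_bigmax _ _ (ord0, i)).
Qed.

Lemma normr_rV_le x e : 0 <= e -> (forall i, `|x ord0 i| <= e) -> `|x| <= e.
Proof.
move=> e0 xe; rewrite [leLHS]/Num.Def.normr/= mx_normrE (bigmax_le _ e0)//=.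
by move=> -[i j] _ /=; rewrite (ord1 i).
Qed.

Lemma dotvDr p x y : dotv p (x + y) = dotv p x + dotv p y.
Proof. by rewrite -big_split; apply: eq_bigr => i _; rewrite mxE mulrDr. Qed.

Lemma dotvZr p a x : dotv p (a *: x) = a * dotv p x.
Proof. by rewrite /dotv mulr_sumr; apply: eq_bigr => i _; rewrite mxE mulrCA. Qed.

Lemma dotvNr p x : dotv p (- x) = - dotv p x.
Proof. by rewrite -scaleN1r dotvZr mulN1r. Qed.

Lemma dotvBr p x y : dotv p (x - y) = dotv p x - dotv p y.
Proof. by rewrite dotvDr dotvNr. Qed.

Lemma dotvC x y : dotv x y = dotv y x.
Proof. by apply: eq_bigr => i _; rewrite mulrC. Qed.

Lemma dotvZl a x y : dotv (a *: x) y = a * dotv x y.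
Proof. by rewrite dotvC dotvZr dotvC. Qed.

Lemma dotv_ge0 x : 0 <= dotv x x.
Proof. by apply: sumr_ge0 => i _; rewrite -expr2 sqr_ge0. Qed.

Lemma dotv_sqD x y : dotv (x + y) (x + y) = dotv x x + 2 * dotv x y + dotv y y.
Proof.
by rewrite dotvDr (dotvC (x + y) x) (dotvC (x + y) y) !dotvDr (dotvC y x); ring.
Qed.

Lemma enorm_sq x : enorm x ^+ 2 = dotv x x.
Proof. by rewrite sqr_sqrtr// dotv_ge0. Qed.

Lemma dotv_le x y : dotv x y <= n%:R * (`|x| * `|y|).
Proof.
rewrite -[n in n%:R]card_ord -sum1_card natr_sum mulr_suml.
apply: ler_sum => i _; rewrite mul1r (le_trans (ler_norm _))// normrM.
by rewrite ler_pM// normr_coord_le.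
Qed.

Lemma normr_sq_le_dotv x : `|x| ^+ 2 <= dotv x x.
Proof.
rewrite -(@ler_sqrt _ _ (dotv x x)) ?dotv_ge0// sqrtr_sqr normr_id.
apply: normr_rV_le; first exact: sqrtr_ge0.
move=> i; rewrite -sqrtr_sqr ler_sqrt ?dotv_ge0// /dotv (bigD1 i)//= -expr2.
by rewrite lerDl sumr_ge0// => j _; rewrite -expr2 sqr_ge0.
Qed.

Lemma is_derive_coord phi t v i :
  is_derive t 1 phi v -> is_derive t 1 (fun s => phi s ord0 i) (v ord0 i).
Proof.
move=> [dphi <-]; apply: DeriveDef; first exact: (derivable_mxP _ _ _).1.
by rewrite derive_mx// mxE.
Qed.

Lemma is_derive_rV phi t v :
  (forall i, is_derive t 1 (fun s => phi s ord0 i) (v ord0 i)) ->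
  is_derive t 1 phi v.
Proof.
move=> dphi; have d : derivable phi t 1.
  by apply/derivable_mxP => i j; rewrite (ord1 i); case: (dphi j).
apply: DeriveDef => //; rewrite derive_mx//; apply/rowP => i.
by rewrite mxE; case: (dphi i).
Qed.

Lemma is_derive_dotv p phi t v :
  is_derive t 1 phi v -> is_derive t 1 (fun s => dotv p (phi s)) (dotv p v).
Proof.
move=> dphi; have := @is_derive_sum _ _ _ _ (fun i s => p ord0 i * phi s ord0 i)
  t 1 (fun i => p ord0 i * v ord0 i) _.
rewrite [X in is_derive _ _ X _](_ : _ = fun s => dotv p (phi s)); last first.
  by apply/funext => s; rewrite fct_sumE.
apply=> i; have di := is_derive_coord i dphi; exact: is_deriveZ.
Qed.

Lemma is_derive_continuous (W : normedModType R) (psi : R -> W) t (w : W) :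
  is_derive t 1 psi w -> {for t, continuous psi}.
Proof. by case=> d _; apply/differentiable_continuous/derivable1_diffP. Qed.

(** The mean value theorem is applied to each coordinate; with the sup norm the coordinate bounds
    reassemble with the same constant. *)
Lemma MVT_rV phi (dphi : R -> 'rV[R]_n) a b M : a <= b ->
  (forall t, a <= t <= b -> is_derive t 1 phi (dphi t)) ->
  (forall t, a <= t <= b -> `|dphi t| <= M) ->
  `|phi b - phi a| <= M * (b - a).
Proof.
move=> ab dd dM; have M0 : 0 <= M by apply: le_trans (dM a _); rewrite ?lexx.
apply: normr_rV_le; first by rewrite mulr_ge0 ?subr_ge0.
move=> i; rewrite !mxE.
have di t : a <= t <= b ->
    is_derive t 1 (fun s => phi s ord0 i) (dphi t ord0 i).
  by move=> tab; apply: is_derive_coord; exact: dd.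
have [t||c + ->] := @MVT_segment R (fun s => phi s ord0 i)
    (fun t => dphi t ord0 i) a b ab.
- by rewrite in_itv/= => /andP[/ltW a_t /ltW tb]; apply: di; rewrite a_t.
- apply: continuous_in_subspaceT => t; rewrite inE/= in_itv/= => tab.
  exact: is_derive_continuous (di _ tab).
- rewrite in_itv/= => cab; rewrite normrM (ger0_norm (_ : 0 <= b - a)) ?subr_ge0//.
  by rewrite ler_wpM2r ?subr_ge0// (le_trans (normr_coord_le _ _))// dM.
Qed.

End RowVectors.

(** * Primitives of continuous vector functions *)

Section Primitive.
Context {R : realType} {n : nat}.
Implicit Types (v w : R -> 'rV[R]_n) (b t : R).

Let mu := @lebesgue_measure R.

Lemma primitive_exists (v : R -> R) b : 0 < b -> continuous v ->
  exists F : R -> R, F 0 = 0 /\ forall t : R, `|t| < b -> is_derive t 1 F (v t).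
Proof.
move=> b0 cv.
(* Integrating from [- b] makes 0 an interior point, so that the derivative there is two-sided. *)
pose G t := (\int[mu]_(s in `[- b, t]) v s)%R.
exists (fun t => G t - G 0); split=> [|t tb]; first by rewrite subrr.
have [|||] := @continuous_FTC1_closed R v (- b) t b _ _ _ (cv t).
- by rewrite (le_lt_trans (ler_norm _)).
- apply: continuous_compact_integrable;
    [exact: segment_compact|exact: continuous_subspaceT].
- by rewrite ltrNl (le_lt_trans _ tb)// -normrN ler_norm.
rewrite derive1E => dG GE.
have dG' : is_derive t 1 (G : R -> R) (v t) by apply: DeriveDef.
rewrite -[v t]subr0; exact: is_deriveB.
Qed.

Lemma primitive_rV_exists v b : 0 < b -> continuous v ->
  exists F : R -> 'rV[R]_n,
    F 0 = 0 /\ forall t : R, `|t| < b -> is_derive t 1 F (v t).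
Proof.
move=> b0 cv.
have cvi i : continuous (fun t => v t ord0 i).
  move=> t; apply: (@continuous_comp _ _ _ v (fun x : 'rV[R]_n => x ord0 i)).
    exact: cv.
  exact: coord_continuous.
have /choice[F FP] i := primitive_exists b0 (cvi i).
exists (fun t => \row_i F i t); split.
  by apply/rowP => i; rewrite !mxE; case: (FP i).
move=> t tb; apply: is_derive_rV => i.
rewrite [X in is_derive _ _ X _](_ : _ = F i); first exact: (FP i).2.
by apply/funext => s; rewrite mxE.
Qed.

End Primitive.

(** * Local existence for autonomous Lipschitz equations *)

Section Picard.
Context {R : realType} {n : nat}.
Implicit Types (x y : 'rV[R]_n) (phi : R -> 'rV[R]_n) (a b c t : R).

Lemma lipschitz_of_derive phi (dphi : R -> 'rV[R]_n) c M :
  (forall t, `|t| <= c -> is_derive t 1 phi (dphi t)) ->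
  (forall t, `|t| <= c -> `|dphi t| <= M) ->
  forall s t, `|s| <= c -> `|t| <= c -> `|phi s - phi t| <= M * `|s - t|.
Proof.
move=> dd dM s t; wlog st : s t / t <= s.
  move=> H sc tc; have [ts|/ltW st] := leP t s; first exact: H.
  by rewrite distrC [X in _ * X]distrC H.
rewrite !ler_norml => /andP[cs sc] /andP[ct tc].
rewrite (ger0_norm (_ : 0 <= s - t)) ?subr_ge0//.
apply: MVT_rV st _ _ => u /andP[tu us]; [apply: dd|apply: dM];
  by rewrite ler_norml (le_trans ct tu) (le_trans us sc).
Qed.

Lemma geometric_lt (c e : R) : 0 < e -> exists k, c / 2 ^+ k < e.
Proof.
move=> e0; have h1 : `|2^-1 : R| < 1 by rewrite ger0_norm ?invr_ge0//; lra.
have := cvg_geometric c h1.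
move=> /cvgrPdist_lt/(_ e e0)[k _ /(_ k (leqnn k))].
rewrite /geometric/= sub0r normrN exprVn => /(le_lt_trans (ler_norm _)) ?.
by exists k.
Qed.

Lemma le_of_geometric (b b' c : R) :
  (forall k, b <= b' + c / 2 ^+ k) -> b <= b'.
Proof.
move=> H; apply/ler_addgt0Pr => e e0; have [k ke] := geometric_lt c e0.
by rewrite (le_trans (H k))// lerD2l ltW.
Qed.

Lemma cvg_of_geometric (u : nat -> 'rV[R]_n) c :
  (forall k, `|u k.+1 - u k| <= c / 2 ^+ k) ->
  exists l, forall k, `|l - u k| <= 2 * c / 2 ^+ k.
Proof.
move=> uc; have c0 : 0 <= c.
  by have := uc 0%N; rewrite expr0 divr1; exact: le_trans.
have p2 k : (2 : R) ^+ k != 0 by rewrite expf_neq0.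
have bnd k j : `|u (k + j)%N - u k| <= 2 * c / 2 ^+ k - 2 * c / 2 ^+ (k + j).
  elim: j => [|j IH]; first by rewrite addn0 !subrr normr0.
  rewrite addnS -(subrKA (u (k + j)%N)) (le_trans (ler_normD _ _))//.
  have := uc (k + j)%N; set A := c / 2 ^+ (k + j) => uA.
  have -> : 2 * c / 2 ^+ (k + j).+1 = A.
    by rewrite /A exprS; field; rewrite p2.
  by move: IH; rewrite -[2 * c / 2 ^+ (k + j)]mulrA -/A; lra.
have bnd' k m : (k <= m)%N -> `|u m - u k| <= 2 * c / 2 ^+ k.
  move=> km; rewrite -(subnKC km) (le_trans (bnd _ _))// gerDl oppr_le0.
  by rewrite divr_ge0 ?mulr_ge0// exprn_ge0.
have /cvg_ex[l ul] : cvg (u @ \oo).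
  apply/cauchy_cvgP/cauchy_exP => e e0; have [k ke] := geometric_lt (2 * c) e0.
  exists (u k); exists k => // m /= km; rewrite -ball_normE/= distrC.
  exact: le_lt_trans (bnd' _ _ km) ke.
exists l => k; rewrite distrC.
have : (fun m => `|u k - u m|) @ \oo --> `|u k - l|.
  by apply: cvg_norm; apply: cvgB => //; exact: cvg_cst.
move=> /(@closed_cvg _ _ _ eventually_filter _ (fun e => e <= 2 * c / 2 ^+ k)).
apply; first exact: closed_le.
by near=> m; rewrite distrC bnd'//; near: m; exact: nbhs_infty_ge.
Unshelve. all: by end_near. Qed.

Definition clamp a t := if t <= - a then - a else if a <= t then a else t.

Lemma normr_clamp_le a t : 0 <= a -> `|clamp a t| <= a.
Proof.
move=> a0; rewrite /clamp ler_norml.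
by case: (leP t (- a)) => ?; [|case: (leP a t) => ?]; apply/andP; split; lra.
Qed.

Lemma clamp_id a t : `|t| <= a -> clamp a t = t.
Proof.
rewrite ler_norml /clamp => /andP[? ?]; apply/le_anti.
by case: (leP t (- a)) => ?; [|case: (leP a t) => ?]; apply/andP; split; lra.
Qed.

Lemma clamp_nonexpansive a s t : 0 <= a -> `|clamp a s - clamp a t| <= `|s - t|.
Proof.
move=> a0; have := ler_norm (s - t); have := ler_norm (t - s).
rewrite distrC => ? ?; rewrite ler_norml /clamp.
by case: (leP s (- a)); case: (leP t (- a)) => ? ?;
  (try case: (leP a s) => ?); (try case: (leP a t) => ?); apply/andP; split; lra.
Qed.

(* Picard iteration; precomposing with the clamping of time to [-a, a] keeps
   all the iterates globally defined, continuous and inside the ball. *)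
Lemma picard (g : 'rV[R]_n -> 'rV[R]_n) x r L M a :
  0 < a -> 0 <= L -> 0 <= r -> a * L <= 2^-1 -> a * M <= r ->
  (forall y y', `|y - x| <= r -> `|y' - x| <= r ->
     `|g y - g y'| <= L * `|y - y'|) ->
  (forall y, `|y - x| <= r -> `|g y| <= M) ->
  exists phi : R -> 'rV[R]_n, phi 0 = x /\
    forall t, `|t| <= a -> is_derive t 1 phi (g (phi t)) /\ `|phi t - x| <= r.
Proof.
move=> a0 L0 r0 aL aMr gL gM.
have M0 : 0 <= M by apply: le_trans (gM x _); rewrite ?subrr ?normr0.
have b0 : 0 < a + 1 by rewrite addr_gt0.
pose cl := clamp a.
have cla t : `|cl t| <= a by exact/normr_clamp_le/ltW.
have clE t : `|t| <= a -> cl t = t by exact: clamp_id.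
have cl1 s t : `|cl s - cl t| <= `|s - t| by exact/clamp_nonexpansive/ltW.
pose good (y : R -> 'rV[R]_n) := continuous y /\ forall t, `|y t - x| <= r.
have lipgood (y : R -> 'rV[R]_n) : (forall s t, `|y s - y t| <= M * `|s - t|) ->
    (forall t, `|y t - x| <= r) -> good y.
  move=> yM yr; split=> // t; apply/cvgrPdist_lt => e e0.
  have M1 : 0 < M + 1 by rewrite ltr_wpDl.
  apply/nbhs_normP; exists (e / (M + 1)); first exact: divr_gt0.
  move=> s /=; rewrite ltr_pdivlMr// => ts; apply: le_lt_trans (yM _ _) _.
  by apply: le_lt_trans ts; rewrite mulrC ler_wpM2l// lerDl.
(* [Phi y] is the primitive of [g (y t)] vanishing at 0. It is built for [|t| < a + 1], so that it
   is differentiable on both sides of the endpoints [- a] and [a] as well. *)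
have /choice[Phi PhiP] (y : R -> 'rV[R]_n) : exists F : R -> 'rV[R]_n,
    good y -> F 0 = 0 /\ forall t, `|t| <= a -> is_derive t 1 F (g (y t)).
  have [[cy yr]|] := pselect (good y); last by exists y.
  have cgy : continuous (fun t => g (y t)).
    move=> t; apply/cvgrPdist_lt => e e0.
    have L1 : 0 < L + 1 by rewrite ltr_wpDl.
    have /cvgrPdist_lt/(_ _ (divr_gt0 e0 L1)) := cy t.
    apply: filterS => s; rewrite ltr_pdivlMr// => ys.
    apply: (le_lt_trans (gL _ _ (yr _) (yr _))); apply: le_lt_trans ys.
    by rewrite mulrC ler_wpM2l// lerDl.
  have [F [F0 FP]] := primitive_rV_exists b0 cgy.
  by exists F => _; split=> // t ta; apply: FP; rewrite (le_lt_trans ta) ?ltrDl.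
pose y_ := fix y_ k := if k is k'.+1 then (fun t => x + Phi (y_ k') (cl t))
                       else (fun=> x).
have PhiM (y : R -> 'rV[R]_n) : good y -> forall s t,
    `|(x + Phi y (cl s)) - (x + Phi y (cl t))| <= M * `|s - t|.
  move=> gy s t; rewrite opprD addrACA subrr add0r.
  have [_ dP] := PhiP _ gy.
  apply: (le_trans (lipschitz_of_derive dP _ (cla s) (cla t))).
    by move=> u _; apply: gM; case: gy.
  by rewrite ler_wpM2l.
have Phir (y : R -> 'rV[R]_n) t : good y -> `|x + Phi y (cl t) - x| <= r.
  move=> gy; rewrite addrC addKr.
  have [P0 dP] := PhiP _ gy.
  rewrite -[Phi y _]subr0 -P0.
  apply: (le_trans (lipschitz_of_derive dP _ (cla t) _)).
  - by move=> u _; apply: gM; case: gy.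
  - by rewrite normr0 ltW.
  - by rewrite subr0 (le_trans _ aMr)// mulrC ler_wpM2r.
have gy k : good (y_ k).
  elim: k => [|k IH] /=; last by apply: lipgood => *; [exact: PhiM|exact: Phir].
  by apply: lipgood => *; rewrite subrr normr0 ?mulr_ge0.
(* Contraction by 1/2, from [a * L <= 1/2]; it will serve both for the convergence of the iterates
   and for identifying their limit. *)
have contr (y y' : R -> 'rV[R]_n) e : good y -> good y' -> 0 <= e ->
    (forall t, `|y t - y' t| <= e) ->
    forall t, `|x + Phi y (cl t) - (x + Phi y' (cl t))| <= e / 2.
  move=> hy hy' e0 yy' t; rewrite opprD addrACA subrr add0r.
  have [P0 dP] := PhiP _ hy; have [P0' dP'] := PhiP _ hy'.
  have dd (s : R) : `|s| <= a ->
      is_derive s 1 (Phi y - Phi y') (g (y s) - g (y' s)).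
    by move=> sa; have ds := dP _ sa; have ds' := dP' _ sa; exact: is_deriveB.
  have := lipschitz_of_derive (M := L * e) dd _ (cla t) (_ : `|0| <= a).
  rewrite !fctE P0 P0' !subr0 normr0 => H; apply: (le_trans (H _ _)).
  - move=> s sa; apply: (le_trans (gL _ _ (hy.2 _) (hy'.2 _))).
    by rewrite ler_wpM2l.
  - exact: ltW.
  - have := ler_wpM2l (mulr_ge0 L0 e0) (cla t); have := ler_wpM2l e0 aL.
    by move: (`|cl t|) => ct; lra.
have step k : forall t, `|y_ k.+1 t - y_ k t| <= r / 2 ^+ k.
  elim: k => [|k IH] t; first by rewrite expr0 divr1; exact: Phir (gy 0%N).
  rewrite exprSr invfM mulrA; apply: (contr _ _ _ (gy k.+1) (gy k)) => //.
  by rewrite divr_ge0// exprn_ge0.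
have /choice[y yP] t : exists l, forall k, `|l - y_ k t| <= 2 * r / 2 ^+ k.
  by apply: (@cvg_of_geometric (fun k => y_ k t)) => k; exact: step.
have yr t : `|y t - x| <= r.
  apply: (@le_of_geometric _ _ (2 * r)) => k.
  rewrite -(subrKA (y_ k t)) (le_trans (ler_normD _ _))// addrC.
  by apply: lerD (yP _ _); exact: (gy k).2.
have yLM k s t : `|y_ k s - y_ k t| <= M * `|s - t|.
  case: k => [|k]; [by rewrite subrr normr0 mulr_ge0|exact: PhiM].
have yM s t : `|y s - y t| <= M * `|s - t|.
  apply: (@le_of_geometric _ _ (4 * r)) => k.
  have := yP s k; have := yP t k; have := yLM k s t.
  have := ler_normD (y s - y_ k s) (y_ k s - y t); rewrite subrKA.
  have := ler_normD (y_ k s - y_ k t) (y_ k t - y t); rewrite subrKA.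
  by rewrite [`|y_ k t - _|]distrC; lra.
have gY : good y by exact: lipgood.
(* The limit is itself [good], so contraction applies to it, and its defect in the integral equation
   is at most [2 * r / 2 ^+ k] for every [k]. *)
have yE t : y t = x + Phi y (cl t).
  apply/eqP; rewrite -subr_eq0 -normr_le0.
  apply: (@le_of_geometric _ _ (2 * r)) => k; rewrite add0r.
  rewrite -(subrKA (y_ k.+1 t)) (le_trans (ler_normD _ _))//.
  have h1 := yP t k.+1.
  have h2 : `|y_ k.+1 t - (x + Phi y (cl t))| <= 2 * r / 2 ^+ k / 2.
    apply: (contr _ _ _ (gy k) gY); first by rewrite divr_ge0 ?mulr_ge0// exprn_ge0.
    by move=> s; rewrite distrC.
  rewrite (le_trans (lerD h1 h2))// exprSr invfM mulrA.
  by rewrite -splitr.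
have [Py0 dPy] := PhiP _ gY.
exists (fun t => x + Phi y t); split; first by rewrite Py0 addr0.
move=> t ta; have <- : y t = x + Phi y t by rewrite yE clE.
split=> //; have dP := dPy _ ta.
rewrite -[g _]add0r; exact: is_deriveD.
Qed.

End Picard.

(** * Uniform radii on compact sets *)

Section CompactRadius.
Context {R : realType} {V : normedModType R}.
Implicit Types (K D O : set V) (a b : V) (r s e : R).

(** A form of Lebesgue's number lemma. The local hypothesis covers every small radius [s], so
    finitely many neighbourhoods can share one. *)
Lemma compact_radius K (P : R -> V -> Prop) : compact K ->
  (forall a, K a -> exists2 r, 0 < r &
     forall b s, `|b - a| < r -> 0 < s <= r -> P s b) ->
  exists2 r, 0 < r & forall b, K b -> P r b.
Proof.
move=> /compact_near_coveringP cK loc.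
have /(cK _ (0 : R)^'+ P _) : forall a, K a ->
    \forall b \near a & s \near (0 : R)^'+, P s b.
  move=> a /loc[r r0 rP].
  exists (ball a r, [set s | 0 < s < r]) => /=.
    split; first exact: nbhsx_ballx.
    exists r => //= s /=; rewrite sub0r normrN => sr s0.
    by rewrite s0 (le_lt_trans (ler_norm _)).
  move=> [b s] /= [ab /andP[s0 sr]]; apply: rP; last by rewrite s0 ltW.
  by move: ab; rewrite -ball_normE/= distrC.
move=> H; have : \forall s \near (0 : R)^'+, 0 < s /\ K `<=` P s.
  near=> s; split; near: s; [exact: nbhs_right_gt|exact: H].
by move=> /filter_ex[r [r0 rP]]; exists r.
Unshelve. all: by end_near. Qed.

Lemma within_continuousP D (g : V -> R) a : {within D, continuous g} -> D a ->
  forall e, 0 < e -> exists2 d, 0 < d &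
    forall b, D b -> `|b - a| < d -> `|g b - g a| < e.
Proof.
move=> /(_ a) cg Da e e0.
have /cvgrPdist_lt/(_ e e0) : g x @[x --> within D (nbhs a)] --> g a.
  by move: cg; rewrite /continuous_at nbhs_subspace_in.
rewrite near_withinE => /nbhs_normP[d /= d0 dP].
by exists d => // b Db ba; rewrite distrC; apply: dP => //=; rewrite distrC.
Qed.

(** Only [a] is confined to the compact set; [b] ranges over [D], because arcs starting in [K] may
    leave it. *)
Lemma compact_uniform_continuity K D (g : V -> R) e :
  compact K -> K `<=` D -> {within D, continuous g} -> 0 < e ->
  exists2 r, 0 < r & forall a, K a ->
    forall b, D b -> `|b - a| < r -> `|g b - g a| < e.
Proof.
move=> cK KD cg e0; pose P s a := D a -> forall b, D b -> `|b - a| < s ->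
  `|g b - g a| < e.
have [a Ka|r r0 rP] := compact_radius (P := P) cK; last first.
  by exists r => // a Ka b; apply: rP => //; exact: KD.
have e2 : 0 < e / 2 by rewrite divr_gt0.
have [d d0 dP] := within_continuousP cg (KD _ Ka) e2.
exists (d / 2) => [|b s ba /andP[s0 sd] Db b' Db' b'b]; first by rewrite divr_gt0.
have b'a : `|b' - a| < d.
  by rewrite -(subrKA b) (le_lt_trans (ler_normD _ _))//; lra.
have ba' : `|b - a| < d by lra.
have := dP _ Db' b'a; have := dP _ Db ba'.
by have := ler_normD (g b' - g a) (g a - g b);
  rewrite subrKA [`|g a - _|]distrC; lra.
Qed.

Lemma compact_thickening K O : compact K -> open O -> K `<=` O ->
  exists2 r, 0 < r & forall a, K a -> forall b, `|b - a| < r -> O b.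
Proof.
move=> cK oO KO; pose P s a := forall b, `|b - a| < s -> O b.
have [a Ka|r r0 rP] := compact_radius (P := P) cK; last by exists r.
have /nbhs_normP[d /= d0 dP] : nbhs a O by apply: open_nbhs_nbhs; split; auto.
exists (d / 2) => [|b s ba /andP[s0 sd] b' b'b]; first by rewrite divr_gt0.
apply: dP => /=; rewrite distrC -(subrKA b) (le_lt_trans (ler_normD _ _))//; lra.
Qed.

(** The radius and the Lipschitz constant are governed by one parameter, the constant being the
    inverse of the radius. This fits [compact_radius] and yields [L * r <= 1]. *)
Lemma compact_lipschitz_unif (W : normedModType R) (T : Type) (A : set T)
    (g : V -> T -> W) K : locally_lipschitz_unif A g -> compact K ->
  exists L r, [/\ 0 < L, 0 < r, L * r <= 1 &
    forall a, K a -> forall u, A u -> forall b b',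
      `|b - a| < r -> `|b' - a| < r -> `|g b u - g b' u| <= L * `|b - b'|].
Proof.
move=> gl cK; pose P r a := forall u, A u -> forall b b',
    `|b - a| < r -> `|b' - a| < r -> `|g b u - g b' u| <= r^-1 * `|b - b'|.
have [a Ka|r r0 rP] := compact_radius (P := P) cK; last first.
  by exists r^-1, r; split; rewrite ?invr_gt0// mulVf// gt_eqF.
have [k [B /nbhs_normP[d /= d0 dB] kB]] := gl a.
have k1 : 0 < `|k| + 1 by rewrite ltr_wpDl.
exists (Num.min (d / 2) (`|k| + 1)^-1).
  by rewrite lt_min divr_gt0//= invr_gt0.
move=> b s; rewrite lt_min le_min => /andP[ba _] /andP[s0 /andP[sd sk]].
move=> u Au c c' cb c'b.
have inB x : `|x - b| < s -> B x.
  move=> xb; apply: dB => /=; rewrite distrC.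
  by rewrite -(subrKA b) (le_lt_trans (ler_normD _ _))//; lra.
apply: (le_trans (kB _ Au (c, c') (conj (inB _ cb) (inB _ c'b)))) => /=.
rewrite ler_wpM2r// (le_trans (ler_norm _))//.
rewrite -[X in X <= _]addr0 -[s^-1]invrK ; apply: le_trans (_ : `|k| + 1 <= _).
  by rewrite addr0 lerDl.
by rewrite invrK -[leLHS]invrK lef_pV2// posrE invr_gt0.
Qed.

End CompactRadius.

Lemma compact_bounded_unif (R : realType) (V X : normedModType R)
    (Y : normedModType R) (A : set X) (g : V -> X -> Y) (K : set V) :
  compact A -> compact K ->
  {within [set: V] `*` A, continuous (fun xu => g xu.1 xu.2)} ->
  exists2 M : R, 0 < M & forall a u, K a -> A u -> `|g a u| <= M.
Proof.
move=> cA cK cg.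
have /compact_bounded[M [_ Mb]] :
    compact ((fun xu : V * X => g xu.1 xu.2) @` (K `*` A)).
  apply: continuous_compact; last exact: compact_setX.
  by apply: continuous_subspaceW cg => -[x u] [/= _ Au].
exists (`|M| + 1); first by rewrite ltr_wpDl.
move=> a u Ka Au; apply: Mb; last by exists (a, u).
by rewrite (le_lt_trans (ler_norm _))// ltrDl.
Qed.

(** * Regularization by inf-convolution and its decrease along arcs *)

Section Moreau.
Context {R : realType} {n : nat}.
Implicit Types (K : set 'rV[R]_n) (W : 'rV[R]_n -> R) (x y : 'rV[R]_n).

Definition moreau K W (kappa : R) x : R :=
  inf [set W y + kappa * dotv (x - y) (x - y) | y in K].

Context {K : set 'rV[R]_n} {W : 'rV[R]_n -> R} {kappa : R}.
Hypothesis kappa_ge0 : 0 <= kappa.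
Hypothesis W_ge0 : forall y, K y -> 0 <= W y.

Lemma moreau_le x y : K y ->
  moreau K W kappa x <= W y + kappa * dotv (x - y) (x - y).
Proof.
move=> Ky; apply: ge_inf; last by exists y.
by exists 0 => _ [y' Ky' <-]; rewrite addr_ge0 ?W_ge0 ?mulr_ge0 ?dotv_ge0.
Qed.

Lemma moreau_attained x : compact K -> K !=set0 -> {within K, continuous W} ->
  exists2 y, K y & moreau K W kappa x = W y + kappa * dotv (x - y) (x - y).
Proof.
move=> cK K0 cW.
have cQ : continuous (fun y => kappa * dotv (x - y) (x - y)).
  move=> y; apply: (@cvgM R _ (nbhs y) _ (cst kappa) (fun y => dotv (x - y) (x - y))).
    exact: cvg_cst.
  apply: (@continuous_big _ _ _ _ xpredT add_continuous _ _
    (fun i (y : 'rV[R]_n) => (x - y) ord0 i * (x - y) ord0 i)) => i _ {}y.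
  have cc : {for y, continuous (fun y : 'rV[R]_n => (x - y) ord0 i)}.
    apply: (@continuous_comp _ _ _ (fun y => x - y) (fun x : 'rV[R]_n => x ord0 i)).
      by apply: (@cvgB _ _ _ (nbhs y) _ (cst x) id); [exact: cvg_cst|exact: cvg_id].
    exact: coord_continuous.
  exact: (@cvgM _ _ _ _ _ _ _ _ cc cc).
have [|y] := @compact_EVT_min _ R (fun y => W y + kappa * dotv (x - y) (x - y)) K K0 cK.
  by apply: within_continuousD => //; exact: continuous_subspaceT.
rewrite inE => Ky yP; exists y => //; apply/le_anti; rewrite moreau_le//=.
apply: lb_le_inf; first by exists (W y + kappa * dotv (x - y) (x - y)), y.
by move=> _ [y' Ky' <-]; apply: yP; rewrite inE.
Qed.

(** Expanding [|x - v|^2] around [y] turns the minimality of [y] into the proximal inequality with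
    [sigma = kappa]; it is global, so any [eta] will do. The infimum is over [K] and the
    subdifferential over [D], hence the separate hypothesis on [D]. *)
Lemma moreau_proximal (D : set 'rV[R]_n) x y : 0 < kappa ->
  moreau K W kappa x = W y + kappa * dotv (x - y) (x - y) ->
  (forall v, D v -> moreau K W kappa x <= W v + kappa * dotv (x - v) (x - v)) ->
  proximal_subdifferential D W y ((2 * kappa) *: (x - y)).
Proof.
move=> k0 Vx VD; exists kappa, 1; split=> // v Dv _; move: (VD _ Dv).
have -> : x - v = (x - y) + - (v - y) by rewrite opprB subrKA.
rewrite Vx enorm_sq dotvZl; move: (x - y) (v - y) => q d.
by rewrite dotv_sqD !dotvNr [dotv (- _) _]dotvC dotvNr; lra.
Qed.

(* The only term of order h is the directional derivative at the minimizer y;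
   replacing g (phi t) by g y costs kappa |x - y|^2, which is small by the
   continuity of W even though kappa is large. *)
Lemma moreau_descent (g : 'rV[R]_n -> 'rV[R]_n) (phi : R -> 'rV[R]_n) x y
    (h L M : R) :
  0 < h -> 0 <= L -> 0 <= M -> K y ->
  moreau K W kappa x = W y + kappa * dotv (x - y) (x - y) ->
  phi 0 = x -> (forall t, 0 <= t <= h -> is_derive t 1 phi (g (phi t))) ->
  (forall t, 0 <= t <= h -> `|phi t - x| <= M * h) ->
  (forall t, 0 <= t <= h -> `|g (phi t) - g y| <= L * `|phi t - y|) ->
  `|x - y| <= 1 ->
  moreau K W kappa (phi h) <= moreau K W kappa x +
    h * (2 * kappa * dotv (x - y) (g y) +
         2 * (n%:R * L * (kappa * `|x - y| ^+ 2)) +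
         h * (kappa * n%:R * (2 * L * M + M ^+ 2))).
Proof.
move=> h0 L0 M0 Ky Vx phi0 dphi phiM gL q1; set q := x - y in Vx q1 *.
have [||s sI Es] := @MVT_segment R (fun t => dotv q (phi t))
    (fun t => dotv q (g (phi t))) 0 h (ltW h0).
- move=> t; rewrite in_itv/= => /andP[/ltW t0 /ltW th].
  by apply: is_derive_dotv; apply: dphi; rewrite t0.
- apply: continuous_in_subspaceT => t; rewrite inE/= in_itv/= => th.
  by apply: is_derive_continuous; apply: is_derive_dotv; exact: dphi.
rewrite in_itv/= in sI.
pose d := phi h - x; pose b := dotv q (g (phi s) - g y).
have dq : dotv q d = (dotv q (g y) + b) * h.
  by rewrite /b dotvBr addrC subrK /d dotvBr -phi0 Es subr0.
have kN : 0 <= kappa * n%:R by rewrite mulr_ge0.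
have hb : kappa * b <= n%:R * L * (kappa * `|q| ^+ 2) + kappa * n%:R * L * M * h.
  have gsL : `|g (phi s) - g y| <= L * (M * h + `|q|).
    rewrite (le_trans (gL _ sI))// ler_wpM2l//.
    by have := ler_normD (phi s - x) (x - y); have := phiM _ sI;
      rewrite subrKA -/q; clear; lra.
  have : b <= n%:R * (`|q| * (L * (M * h + `|q|))).
    by rewrite (le_trans (dotv_le _ _))// ler_wpM2l// ler_wpM2l.
  move=> /(ler_wpM2l kappa_ge0)/le_trans; apply.
  have : kappa * n%:R * L * M * h * `|q| <= kappa * n%:R * L * M * h.
    by apply: ler_piMr q1; rewrite mulr_ge0 ?(ltW h0)// !mulr_ge0.
  by clear; lra.
have hd : kappa * dotv d d <= kappa * n%:R * M ^+ 2 * h ^+ 2.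
  have -> : kappa * n%:R * M ^+ 2 * h ^+ 2 = kappa * (n%:R * ((M * h) * (M * h))).
    by ring.
  rewrite ler_wpM2l// (le_trans (dotv_le _ _))// ler_wpM2l// ler_pM// /d;
    by apply: phiM; rewrite lexx ltW.
(* The old minimizer [y] is kept as a competitor at the endpoint [phi h]; the square of [q + d] then
   gives the first-order term [2 * dotv q d] and the second-order term [dotv d d]. *)
rewrite (le_trans (moreau_le (phi h) Ky))// Vx.
have -> : phi h - y = q + d by rewrite [RHS]addrC /d /q subrKA.
by rewrite dotv_sqD dq; move: (ler_wpM2l (ltW h0) hb) hd; clear; lra.
Qed.

End Moreau.

(** The derivative is two-sided even at 0 and [h]. The Lipschitz bound is recorded because gluing
    derives absolute continuity from it. *)
Definition control_arc (R : realType) (n m : nat)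
    (f : 'rV[R]_n -> 'rV[R]_m -> 'rV[R]_n) (u : 'rV[R]_m) (h : R)
    (phi : R -> 'rV[R]_n) : Prop :=
  (forall t, 0 <= t <= h -> is_derive t 1 phi (f (phi t) u)) /\
  exists M : R, forall s t, 0 <= s <= h -> 0 <= t <= h ->
    `|phi s - phi t| <= M * `|s - t|.

(** * Decrease of the regularization within one band, and the sequence of pieces *)

Section Band.
Context {R : realType} {n m : nat}.
Context {U : set 'rV[R]_m} {C : set 'rV[R]_n}.
Context {f : 'rV[R]_n -> 'rV[R]_m -> 'rV[R]_n} {l : 'rV[R]_n -> 'rV[R]_m -> R}.
Context {p0 gamma : R -> R} {W : 'rV[R]_n -> R}.
Hypothesis U_compact : compact U.
Hypothesis C_closed : closed C.
Hypothesis f_cont : {within [set: 'rV[R]_n] `*` U,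
                      continuous (fun xu => f xu.1 xu.2)}.
Hypothesis l_cont : {within [set: 'rV[R]_n] `*` U,
                      continuous (fun xu => l xu.1 xu.2)}.
Hypothesis l_ge0 : forall x u, U u -> 0 <= l x u.
Hypothesis f_lip : locally_lipschitz_unif U f.
Hypothesis l_lip : locally_lipschitz_unif U l.
Hypothesis p0_cont : {within `]0, +oo[, continuous p0}.
Hypothesis p0_range : forall s : R, 0 < s -> 0 <= p0 s <= 1.
Hypothesis gamma_cont : {within `]0, +oo[, continuous gamma}.
Hypothesis gamma_incr : {in `]0, +oo[ &, {homo gamma : s t / s < t}}.
Hypothesis gamma_gt0 : forall s : R, 0 < s -> 0 < gamma s.
Hypothesis W_mrf : minimum_restraint_function C U f l p0 gamma W.

Local Notation D := (closure (~` C)).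
Local Notation rate x u := (p0 (W x) * l x u + gamma (W x)).

Local Ltac goal_lra :=
  clear - U_compact C_closed f_cont l_cont l_ge0 f_lip l_lip p0_cont p0_range
    gamma_cont gamma_incr gamma_gt0 W_mrf; lra.

Lemma notC_domain x : ~ C x -> D x.
Proof. exact: subset_closure. Qed.

Lemma W_gt0_notC x : D x -> 0 < W x -> ~ C x.
Proof.
move=> Dx Wx0 Cx; have [_ _ [_ W0] _ _] := W_mrf.
suff : boundary C x by move=> /W0 Wx; rewrite Wx ltxx in Wx0.
split; first exact: subset_closure.
by move: Dx; rewrite closure_setC.
Qed.

Lemma W_gt0 x : ~ C x -> 0 < W x.
Proof. by case: W_mrf => _ _ [+ _] _ _; exact. Qed.

Lemma sublevel_compact a b : 0 <= a -> compact [set x | D x /\ a <= W x <= b].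
Proof.
move=> a0; have [_ _ _ Wp _] := W_mrf.
rewrite (_ : mkset _ = closure (~` C) `&` W @^-1` `[a, b]).
  apply: Wp; first exact: segment_compact.
  by move=> s /=; rewrite !in_itv/= andbT => /andP[/(le_trans a0)].
by apply/seteqP; split=> x /=; rewrite in_itv.
Qed.

Lemma comp_W_continuous (g : R -> R) :
  {within `]0, +oo[, continuous g} -> {within ~` C, continuous (g \o W)}.
Proof.
rewrite continuous_open_subspace; last exact: interval_open.
move=> cg; apply: within_continuous_comp.
  move=> _ /[1!inE] -[x Cx <-]; apply: cg; rewrite inE/= in_itv/= andbT.
  exact: W_gt0.
have [_ cW _ _ _] := W_mrf.
by apply: continuous_subspaceW cW; exact: subset_closure.
Qed.

(** The increment is split so that [l] needs a bound only at [a] in [K]: the increment of [p0]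
    multiplies [l a u], and that of [l] is multiplied by [p0 (W b) <= 1]. *)
Lemma rate_uniform K e : compact K -> K `<=` ~` C -> 0 < e ->
  exists2 r, 0 < r & forall a b u, K a -> ~ C b -> U u -> `|b - a| < r ->
    `|rate b u - rate a u| <= e.
Proof.
move=> cK KC e0.
have [M M0 lM] := compact_bounded_unif U_compact cK l_cont.
have [L [r1 [L0 r10 Lr1 lipl]]] := compact_lipschitz_unif l_lip cK.
have e3 : 0 < e / 3 by rewrite divr_gt0.
have [r2 r20 p0P] := compact_uniform_continuity cK KC
  (comp_W_continuous p0_cont) (divr_gt0 e3 M0).
have [r3 r30 gaP] := compact_uniform_continuity cK KC
  (comp_W_continuous gamma_cont) e3.
exists (Num.min (Num.min r1 (r1 * (e / 3))) (Num.min r2 r3)).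
  by rewrite !lt_min r10 r20 r30 mulr_gt0.
move=> a b u Ka Cb Uu; rewrite !lt_min => /andP[/andP[b1 be] /andP[b2 b3]].
have /andP[p0b p1b] := p0_range (W_gt0 Cb).
have h1 := lipl _ Ka _ Uu b a b1 (_ : `|a - a| < r1).
rewrite subrr normr0 in h1; have {}h1 := h1 r10.
have {}h1 : `|l b u - l a u| <= e / 3.
  rewrite (le_trans h1)// (le_trans (ler_wpM2l (ltW L0) (ltW be)))// mulrA.
  by rewrite ler_piMl// ltW.
have h2 := gaP _ Ka _ Cb b3; have h3 := p0P _ Ka _ Cb b2; rewrite /= in h2 h3.
have h4 := lM _ _ Ka Uu.
have -> : rate b u - rate a u = (p0 (W b) - p0 (W a)) * l a u +
   p0 (W b) * (l b u - l a u) + (gamma (W b) - gamma (W a)).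
  by ring.
have h5 : `|(p0 (W b) - p0 (W a)) * l a u| <= e / 3.
  rewrite normrM (le_trans (ler_pM _ _ (ltW h3) h4))//.
  by rewrite divfK// gt_eqF.
have h6 : `|p0 (W b) * (l b u - l a u)| <= e / 3.
  by rewrite normrM (ger0_norm p0b) (le_trans _ h1)// ler_piMl.
rewrite (le_trans (ler_normD _ _))//.
by have := ler_normD ((p0 (W b) - p0 (W a)) * l a u)
  (p0 (W b) * (l b u - l a u)); lra.
Qed.

(** [V] and [h] depend on [w] and [th] alone, not on the starting point, so all the pieces run in
    one band share them. The number [c] dominates the rate along the whole arc, and [c * h] is paid
    for by the drop of [V]. *)
Lemma band w th : 0 < w -> 0 < th <= 2^-1 ->
  exists (V : 'rV[R]_n -> R) (h : R), [/\ 0 < h,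
    forall x, ~ C x -> W x <= 2 * w -> W x - th * w <= V x <= W x &
    forall x, ~ C x -> w / 2 < W x <= 2 * w ->
      exists u phi c, [/\ U u, control_arc f u h phi, phi 0 = x,
        forall s, 0 <= s <= h -> [/\ ~ C (phi s), `|W (phi s) - W x| <= th * w &
                                     rate (phi s) u <= c] &
        c * h <= (1 + th) * (V x - V (phi h)) ] ].
Proof.
move=> w0 /andP[th0 th2]; have [W_ge0 cW _ _ decr] := W_mrf.
pose K := [set x | D x /\ 0 <= W x <= 2 * w].
pose K2 := [set x | D x /\ w / 2 <= W x <= 2 * w].
have cK : compact K by exact: sublevel_compact.
have w20 : 0 < w / 2 by rewrite divr_gt0.
have w40 : 0 < w / 4 by rewrite divr_gt0.
have cK2 : compact K2 by apply: sublevel_compact; exact: ltW.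
have K2C : K2 `<=` ~` C.
  by move=> x [Dx /andP[Wx _]]; apply: W_gt0_notC => //; exact: lt_le_trans Wx.
have KD : K `<=` D by move=> x [].
have inK x : ~ C x -> W x <= 2 * w -> K x.
  by move=> Cx Wx; split; [exact: notC_domain|rewrite Wx ltW// W_gt0].
have [dl dl0 dlE] : exists2 dl, 0 < dl & 4 * dl = th * gamma (w / 4).
  exists (th * gamma (w / 4) / 4); last by field.
  by rewrite divr_gt0// mulr_gt0// gamma_gt0.
have [Mf Mf0 fMf] := compact_bounded_unif U_compact cK2 f_cont.
have [L [rf [L0 rf0 Lrf fL]]] := compact_lipschitz_unif f_lip cK2.
have [M M0 MfM] : exists2 M, 0 < M & Mf + 1 <= M.
  by exists (Mf + 1); rewrite ?addr_gt0.
have [rho rho0 rhoP] := compact_thickening cK2 (closed_openC C_closed) K2C.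
have [rr rr0 rrP] := rate_uniform cK2 K2C (divr_gt0 dl0 (ltr0Sn R 1)).
(* [e1] will bound both [|W y - W x|] and [kappa * |x - y|^2]. Its three bounds keep [V] within
   [th * w] of [W], keep [W y] above [w / 4], and reduce the Lipschitz error of [moreau_descent] to
   [dl / 2]. The factor [n.+1] keeps the divisor positive in dimension 0. *)
have [e1 e10 [e1th e1w e1L]] : exists2 e1, 0 < e1 &
    [/\ e1 <= th * w, e1 <= w / 4 & n%:R * L * e1 <= dl / 4].
  have nL : 0 < n.+1%:R * L by rewrite mulr_gt0.
  exists (Num.min (th * w) (Num.min (w / 4) (dl / 4 / (n.+1%:R * L)))).
    by rewrite !lt_min mulr_gt0// w40 !divr_gt0.
  split; rewrite ?ge_min ?lexx ?orbT//.
  set e1 := Num.min _ _.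
  have e1le : e1 <= dl / 4 / (n.+1%:R * L) by rewrite !ge_min lexx !orbT.
  have e10 : 0 <= e1 by rewrite !le_min ltW ?mulr_gt0// ltW// !divr_ge0// ltW.
  rewrite ler_pdivlMr// in e1le; apply: le_trans e1le.
  by rewrite mulrC ler_wpM2l// ler_wpM2r ?(ltW L0)// ler_nat.
have [r1 r10 r1P] := compact_uniform_continuity cK KD cW e10.
have [r r0 [rrf rrho rrr rr1 r_1]] : exists2 r, 0 < r &
    [/\ r <= rf, r <= rho, r <= rr, r <= r1 & r <= 1].
  exists (Num.min (Num.min rf rho) (Num.min (Num.min rr r1) 1)).
    by rewrite !lt_min rf0 rho0 rr0 r10 ltr01.
  by split; rewrite !ge_min lexx ?orbT.
(* Since [ka * |x - y|^2 <= V x <= W x <= 2 * w < ka * r^2], the minimizer lies within [r] of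
   [x]. *)
have [ka ka0 kaE] : exists2 ka, 0 < ka & ka * r ^+ 2 = 4 * w.
  exists (4 * w / r ^+ 2); rewrite ?divr_gt0 ?mulr_gt0 ?exprn_gt0//.
  by rewrite divfK// expf_neq0// gt_eqF.
(* The three conditions keep the arc within [r / 2] of [x], make Picard's map a contraction, and
   bound the second-order error by the remaining [dl / 2]. *)
have [h h0 [hM hL hB]] : exists2 h, 0 < h & [/\ h * M <= r / 2, h * L <= 2^-1 &
    h * (ka * n%:R * (2 * L * M + M ^+ 2)) <= dl / 2].
  set B := _ * (_ + _); have B1 : 0 < B + 1.
    by rewrite ltr_wpDl// !mulr_ge0// ?addr_ge0 ?sqr_ge0 ?mulr_ge0// ltW.
  exists (Num.min (r / 2 / M) (Num.min (2^-1 / L) (dl / 2 / (B + 1)))).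
    by rewrite !lt_min !divr_gt0// invr_gt0.
  split; [rewrite -ler_pdivlMr// ge_min lexx//|
    rewrite -ler_pdivlMr// !ge_min lexx orbT//|].
  set h := Num.min _ _; have h0 : 0 <= h.
    by rewrite !le_min !divr_ge0// ?invr_ge0// ltW.
  have : h <= dl / 2 / (B + 1) by rewrite !ge_min lexx !orbT.
  by rewrite ler_pdivlMr// mulrDr mulr1; apply: le_trans; rewrite lerDl.
have [V VE] : exists V, V = moreau K W ka by exists (moreau K W ka).
have WK y : K y -> 0 <= W y by case=> _ /andP[].
have VleW x : K x -> V x <= W x.
  move=> Kx; have := moreau_le (ltW ka0) WK x Kx; rewrite -VE.
  by rewrite subrr /dotv big1 ?mulr0 ?addr0// => i _; rewrite mxE mul0r.
have cWK : {within K, continuous W} by exact: continuous_subspaceW cW.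
have Vatt x : ~ C x -> W x <= 2 * w -> exists y, [/\ K y,
    V x = W y + ka * dotv (x - y) (x - y), `|x - y| < r & `|W y - W x| < e1].
  move=> Cx Wx; have Kx := inK _ Cx Wx.
  have [|y Ky] := moreau_attained (ltW ka0) WK x cK _ cWK; first by exists x.
  rewrite -VE => Vy; have xyr : `|x - y| < r.
    have h1 : ka * `|x - y| ^+ 2 <= ka * dotv (x - y) (x - y).
      by rewrite ler_wpM2l ?(ltW ka0)// normr_sq_le_dotv.
    rewrite -(@ltr_pXn2r _ 2)// ?nnegrE ?(ltW r0)// -(@ltr_pM2l _ ka)// kaE.
    by move: (VleW _ Kx) (WK _ Ky) Vy h1 Wx w0; goal_lra.
  exists y; split=> //; apply: r1P => //; first exact: KD.
  by rewrite distrC (lt_le_trans xyr).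
exists V, h; split=> //.
  move=> x Cx Wx; rewrite VleW ?andbT; last exact: inK.
  have [y [Ky -> _]] := Vatt x Cx Wx; have := dotv_ge0 (x - y).
  by rewrite ltr_norml => /(mulr_ge0 (ltW ka0)) + /andP[+ _]; move: e1th; goal_lra.
move=> x Cx /andP[Wx2 Wx]; have Kx := inK _ Cx Wx.
have K2x : K2 x by split; [exact: notC_domain|rewrite Wx ltW].
have [y [Ky Vy xy Wyx]] := Vatt x Cx Wx.
have Wyx' := Wyx; move: Wyx'; rewrite ltr_norml => /andP[Wyx1 Wyx2].
have Cy : ~ C y.
  by apply: (rhoP x) => //; rewrite distrC (lt_le_trans xy).
have [|v [[u Uu uv] _] vga] := decr y ((2 * ka) *: (x - y)) Cy.
  rewrite VE in Vy; apply: (moreau_proximal ka0 Vy) => v Dv; rewrite -VE in Vy *.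
  (* Minimality over [K] extends to [D]: where [W v > 2 * w], already [W v] exceeds [W x], hence
     [V x]. *)
  have [Wv|/ltW Wv] := leP (W v) (2 * w).
    by rewrite VE; apply: moreau_le => //; [exact: ltW|split=> //; rewrite W_ge0].
  rewrite (le_trans (VleW _ Kx))// (le_trans Wx)// (le_trans Wv)// lerDl.
  by rewrite mulr_ge0 ?dotv_ge0// ltW.
have {v uv vga} fyu : 2 * ka * dotv (x - y) (f y u) <= - rate y u.
  by move: vga; rewrite -uv dotvZl; goal_lra.
have fM b : `|b - x| < r -> `|f b u| <= M.
  move=> bx; have xx : `|x - x| < rf by rewrite subrr normr0.
  have := fL _ K2x _ Uu _ _ (lt_le_trans bx rrf) xx; have := fMf _ _ K2x Uu.
  have : L * `|b - x| <= 1.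
    by apply: le_trans Lrf; rewrite ler_wpM2l ?(ltW L0)// ltW// (lt_le_trans bx).
  by have := ler_normD (f b u - f x u) (f x u); rewrite subrK; move: MfM; goal_lra.
have [|b b' xb xb'|b xb|phi [phi0 phiP]] :=
    @picard R n (f^~ u) x (r / 2) L M h h0 (ltW L0) _ hL hM.
- by rewrite divr_ge0// ltW.
- have r2 : r / 2 < rf by move: rrf r0; goal_lra.
  by apply: fL K2x _ Uu _ _ _ _; exact: le_lt_trans r2.
- by apply: fM; move: xb r0; goal_lra.
have hh : `|h| <= h by rewrite ger0_norm// ltW.
have h00 : `|0 : R| <= h by rewrite normr0 ltW.
have abs_h s : 0 <= s <= h -> `|s| <= h by case/andP => ? ?; rewrite ger0_norm.
have phir s : `|s| <= h -> `|phi s - x| < r.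
  by move=> /phiP[_ H]; rewrite (le_lt_trans H)//; move: r0; goal_lra.
have phiL s t : `|s| <= h -> `|t| <= h -> `|phi s - phi t| <= M * `|s - t|.
  apply: lipschitz_of_derive => v' v'h; first exact: (phiP _ v'h).1.
  by apply: fM; exact: phir.
(* Both [y] and the arc stay within [r] of [x], where the rate varies by at most [dl / 2]; so on the
   arc it is at most [rate y u + dl]. *)
exists u, phi, (rate y u + dl); split=> //.
- split; first by move=> t /abs_h/phiP[].
  by exists M => s t /abs_h sh /abs_h th'; exact: phiL.
- move=> s sh; have Cs : ~ C (phi s).
    by apply: (rhoP x) => //; exact: lt_le_trans (phir _ (abs_h _ sh)) _.
  split=> //.
    have := r1P _ Kx _ (notC_domain Cs) (lt_le_trans (phir _ (abs_h _ sh)) rr1).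
    by move=> /ltW/le_trans; apply.
  have := rrP _ _ u K2x Cs Uu (lt_le_trans (phir _ (abs_h _ sh)) rrr).
  have := rrP _ _ u K2x Cy Uu _; rewrite distrC => /(_ (lt_le_trans xy rrr)).
  by rewrite !ler_norml => /andP[+ _] /andP[_ +]; goal_lra.
have key : V (phi h) <= V x - h * (rate y u - dl).
  have kq : ka * `|x - y| ^+ 2 <= e1.
    have : ka * `|x - y| ^+ 2 <= ka * dotv (x - y) (x - y).
      by rewrite ler_wpM2l ?(ltW ka0)// normr_sq_le_dotv.
    by move: (VleW _ Kx) Vy Wyx1; goal_lra.
  have NLe : n%:R * L * (ka * `|x - y| ^+ 2) <= dl / 4.
    by apply: le_trans e1L; rewrite ler_wpM2l// mulr_ge0// ltW.
  have yx : `|y - x| < rf by rewrite distrC (lt_le_trans xy).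
  rewrite VE in Vy *.
  apply: le_trans (moreau_descent (g := f^~ u) (ltW ka0) WK h0 (ltW L0) (ltW M0)
    Ky Vy phi0 _ _ _ (le_trans (ltW xy) r_1)) _.
  - by move=> t /abs_h/phiP[].
  - move=> t th'; have := phiL _ _ (abs_h _ th') h00; rewrite phi0 subr0.
    move=> /le_trans; apply; rewrite ler_wpM2l ?(ltW M0)//; exact: abs_h.
  - by move=> t /abs_h/phir/lt_le_trans/(_ rrf) tx; apply: fL K2x _ Uu _ _ tx yx.
  - rewrite lerD2l -mulrN ler_wpM2l ?(ltW h0)//.
    by move: fyu NLe hB; goal_lra.
have rg : gamma (w / 4) <= rate y u.
  rewrite -[gamma (w / 4)]add0r lerD//.
    by rewrite mulr_ge0 ?l_ge0//; case/andP: (p0_range (W_gt0 Cy)).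
  by apply/ltW/gamma_incr; rewrite ?in_itv/= ?andbT ?W_gt0//;
    move: Wyx1 Wx2 e1w w0; goal_lra.
have h5 := ler_wpM2l (ltW th0) rg.
have h6 : th * dl <= 2^-1 * dl by rewrite ler_wpM2r// ltW.
have h7 : h * (rate y u + dl) <= h * ((1 + th) * (rate y u - dl)).
  by rewrite ler_wpM2l ?(ltW h0)//; move: h5 h6 dl0 dlE; goal_lra.
have h8 := ler_wpM2l (addr_ge0 ler01 (ltW th0)) key.
by rewrite mulrC; move: h7 h8; goal_lra.
Qed.

(** The step length is a function of the level [w k], so steps cannot shrink while the level stays
    the same. The last bound charges the full cost of piece [k] at every time [s] of that piece,
    which controls the supremum over intermediate times. The factor 3 leaves room for [W] to rise by
    [th * w k] along an arc that starts below [2 * w k]. *)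
Lemma piece_sequence z e : ~ C z -> 0 < e ->
  exists (v : nat -> 'rV[R]_m) (phi : nat -> R -> 'rV[R]_n) (c w : nat -> R)
    (h : R -> R), [/\ phi 0%N 0 = z,
    forall k, [/\ U (v k), control_arc f (v k) (h (w k)) (phi k),
      phi k (h (w k)) = phi k.+1 0, 0 < w k & 0 < h (w k)],
    forall k, w k.+1 = w k \/ w k.+1 <= w k / 2 &
    forall k s, 0 <= s <= h (w k) -> [/\ ~ C (phi k s),
      W (phi k s) <= 3 * w k, rate (phi k s) (v k) <= c k &
      \sum_(j < k.+1) c j * h (w j) + W (phi k s) <= W z + e] ].
Proof.
move=> Cz e0; have [W_ge0 cW posW propW decr] := W_mrf.
have Wz0 : 0 < W z by apply: posW.1.
(* At the start [V] and the level are at most [W z], so the invariant requires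
   [(1 + th) * W z + 4 * th * W z = B]; [th] is chosen so that this is at most [W z + e]. *)
pose th := Num.min 2^-1 (e / (5 * W z)).
have th0 : 0 < th by rewrite lt_min invr_gt0 ltr0n divr_gt0// mulr_gt0.
have th2 : th <= 2^-1 by rewrite ge_min lexx.
have thW : 5 * th * W z <= e.
  have : th <= e / (5 * W z) by rewrite ge_min lexx orbT.
  by rewrite ler_pdivlMr ?mulr_gt0//; lra.
pose B := (1 + 5 * th) * W z.
have th02 : 0 < th <= 2^-1 by rewrite th0.
have /choice[Vh VhP] w : exists Vh : ('rV[R]_n -> R) * R, 0 < w -> [/\ 0 < Vh.2,
    forall x, ~ C x -> W x <= 2 * w -> W x - th * w <= Vh.1 x <= W x &
    forall x, ~ C x -> w / 2 < W x <= 2 * w ->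
      exists u phi c, [/\ U u, control_arc f u Vh.2 phi, phi 0 = x,
        forall s, 0 <= s <= Vh.2 -> [/\ ~ C (phi s), `|W (phi s) - W x| <= th * w &
                                     rate (phi s) u <= c] &
        c * Vh.2 <= (1 + th) * (Vh.1 x - Vh.1 (phi Vh.2)) ] ].
  have [w0|w0] := ltP 0 w; last by exists (W, 0).
  have [V [h VP]] := band w0 th02.
  by exists (V, h).
pose V w := (Vh w).1; pose h w := (Vh w).2.
have /choice[st stP] (xw : 'rV[R]_n * R) :
    exists p : 'rV[R]_m * (R -> 'rV[R]_n) * R,
    ~ C xw.1 -> 0 < xw.2 -> xw.2 / 2 < W xw.1 <= 2 * xw.2 ->
    [/\ U p.1.1, control_arc f p.1.1 (h xw.2) p.1.2, p.1.2 0 = xw.1,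
        forall s, 0 <= s <= h xw.2 -> [/\ ~ C (p.1.2 s),
          `|W (p.1.2 s) - W xw.1| <= th * xw.2 & rate (p.1.2 s) p.1.1 <= p.2] &
        p.2 * h xw.2 <= (1 + th) * (V xw.2 xw.1 - V xw.2 (p.1.2 (h xw.2))) ].
  have [[Cx w0 wW]|nP] := pselect
    [/\ ~ C xw.1, 0 < xw.2 & xw.2 / 2 < W xw.1 <= 2 * xw.2].
    have [_ _ /(_ _ Cx wW)[u [phi [c ucP]]]] := VhP _ w0.
    by exists (u, phi, c).
  by exists (0, fun=> 0, 0) => ? ? ?; exfalso; apply: nP.
(* The state is (point, level, accumulated cost). A new level is the current value of [W], at most
   half the old level, so the point lies in its own band. *)
pose next (a : 'rV[R]_n * R * R) :=
  let x1 := (st a.1).1.2 (h a.1.2) in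
  (x1, if a.1.2 / 2 < W x1 then a.1.2 else W x1, a.2 + (st a.1).2 * h a.1.2).
pose S k := iter k next (z, W z, 0).
pose x k := (S k).1.1; pose w k := (S k).1.2; pose A k := (S k).2.
pose v k := (st (S k).1).1.1; pose phi k := (st (S k).1).1.2.
pose c k := (st (S k).1).2.
have xS k : x k.+1 = phi k (h (w k)) by [].
have wS k : w k.+1 = if w k / 2 < W (x k.+1) then w k else W (x k.+1) by [].
have AS k : A k.+1 = A k + c k * h (w k) by [].
(* The reserve 4 th w_k pays for passing from V to W, and then to the V of the
   next band, when w_k is at least halved. *)
pose inv k := [/\ ~ C (x k), 0 < w k <= W z, w k / 2 < W (x k) <= 2 * w k,
  V (w k) (x k) <= w k & A k + (1 + th) * V (w k) (x k) + 4 * th * w k <= B].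
have invS k : inv k -> [/\ [/\ U (v k), control_arc f (v k) (h (w k)) (phi k),
    phi k 0 = x k, 0 < h (w k) & 0 <= c k],
    forall s, 0 <= s <= h (w k) -> [/\ ~ C (phi k s),
       W (phi k s) <= 3 * w k, rate (phi k s) (v k) <= c k &
       A k.+1 + W (phi k s) <= B] &
    inv k.+1].
  move=> [Cx /andP[w0 wz] wW Vw AB].
  have [/= Uv arcv phi0 phiP cV] := stP (S k).1 Cx w0 wW.
  rewrite -/(v k) -/(phi k) -/(c k) -/(x k) -/(w k) in Uv arcv phi0 phiP cV.
  have [h0 Vx _] := VhP _ w0; rewrite -/(h (w k)) -/(V (w k)) in h0 Vx.
  have hI : 0 <= h (w k) <= h (w k) by rewrite lexx ltW.
  have h0I : (0 : R) <= 0 <= h (w k) by rewrite lexx ltW.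
  have ck : 0 <= c k.
    have [Cp _] := phiP _ h0I; apply: le_trans.
    rewrite addr_ge0//; last by rewrite ltW// gamma_gt0// posW.1.
    by rewrite mulr_ge0 ?l_ge0//; case/andP: (p0_range (posW.1 _ Cp)).
  have thw : th * w k <= 2^-1 * w k by rewrite ler_wpM2r// ltW.
  have thw0 : 0 < th * w k by rewrite mulr_gt0.
  have [Cx1 Wx1 _] := phiP _ hI; rewrite -xS in Cx1 Wx1 cV.
  have Wx10 : 0 < W (x k.+1) by exact: posW.1.
  have /andP[wW1 wW2] := wW.
  have /andP[Vx1 Vx2] := Vx _ Cx wW2.
  have V01 : V (w k) (x k.+1) <= V (w k) (x k).
    rewrite -subr_ge0 -(@pmulr_rge0 _ (1 + th)) ?addr_gt0//.
    by apply: le_trans cV; rewrite mulr_ge0// ltW.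
  (* [W] need not decrease from node to node; it is [V <= w k] that persists, and it gives [W (x
     k.+1) <= V + 2 * th * w k <= 2 * w k]. *)
  have Wx1w : W (x k.+1) <= 2 * w k.
    by move: Wx1; rewrite ler_norml => /andP[_ +]; move: Vx1 Vw thw w0; goal_lra.
  have /andP[V11 V12] := Vx _ Cx1 Wx1w.
  have AB1 : A k.+1 + (1 + th) * V (w k) (x k.+1) + 4 * th * w k <= B.
    by rewrite AS; move: cV AB; goal_lra.
  (* From [V] at the end of the piece to [W] inside it takes three errors [th * w k]. What remains
     of the reserve is [th * (V + w k)]; the lower bound on [V] used for its sign is
     [W - th * w k]. *)
  have thV : 0 <= th * (V (w k) (x k.+1) + w k) 
    by rewrite mulr_ge0 ?(ltW th0)//; move: V11 thw w0 Wx10; goal_lra.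
  split=> //.
    move=> s sI; have [Cs Ws cs] := phiP _ sI; split=> //.
      by move: Ws; rewrite ler_norml => /andP[_ +]; move: wW2 thw w0; goal_lra.
    move: Ws Wx1; rewrite !ler_norml => /andP[_ +] /andP[+ _].
    by move: V11 AB1 thV; goal_lra.
  rewrite /inv wS; case: ifPn => [wW'|]; first 
    split; rewrite ?w0 ?wW'//.
    by move: V01 Vw; goal_lra.
  rewrite -leNgt => wW'.
  (* Changing [V] costs [(1 + th) * th * w k], and the new reserve is at most [2 * th * w k]; for
     [th <= 1/2] the sum is below [4 * th * w k]. *)
  have thw' : th * W (x k.+1) <= th * (w k / 2) by rewrite ler_wpM2l// ltW.
  have tthw : th * (th * w k) <= 2^-1 * (th * w k) by rewrite ler_wpM2r// ltW.
  have [_ Vx' _] := VhP _ Wx10.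
  have /andP[_ V'] : W (x k.+1) - th * W (x k.+1) <=
      V (W (x k.+1)) (x k.+1) <= W (x k.+1).
    by apply: Vx' => //; move: Wx10; goal_lra.
  have thV' : (1 + th) * V (W (x k.+1)) (x k.+1) <=
      (1 + th) * (V (w k) (x k.+1) + th * w k).
    by rewrite ler_wpM2l ?addr_ge0 ?(ltW th0)//; move: V11 V'; goal_lra.
  split; rewrite ?Wx10//=.
  - by move: wW' w0 wz; goal_lra.
  - by apply/andP; split; move: Wx10; goal_lra.
  - by move: thV' AB1 thw' tthw thw0; goal_lra.
have inv_ k : inv k.
  elim: k => [|k IH]; last by case: (invS _ IH).
  split=> //=.
  - by rewrite /w/= Wz0 lexx.
  - by rewrite /w /x/=; apply/andP; split; lra.
  - have [_ /(_ z Cz) + _] := VhP _ Wz0.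
    by rewrite /w /x/= => /(_ _)/andP[]//; lra.
  - have [_ /(_ z Cz) + _] := VhP _ Wz0.
    rewrite /w /x /A/= -/(V _) => /(_ _)/andP[]; first by lra.
    move=> _ H; have : (1 + th) * V (W z) z <= (1 + th) * W z.
      by rewrite ler_wpM2l// addr_ge0// ltW.
    by rewrite /B; lra.
have AE k : A k = \sum_(j < k) c j * h (w j).
  elim: k => [|k IH]; first by rewrite big_ord0.
  by rewrite big_ord_recr/= -IH.
have Be : B <= W z + e by rewrite /B; lra.
exists v, phi, c, w, h; split.
- by have [[]] := invS _ (inv_ 0%N).
- move=> k; have [[]] := invS _ (inv_ k); have [[_ _ x1]] := invS _ (inv_ k.+1).
  by rewrite x1; have [_ /andP[]] := inv_ k.
- move=> k; rewrite wS; case: ifPn => [_|]; first by left.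
  by rewrite -leNgt; right.
- move=> k s sI; have [_ /(_ s sI)[? ? ? AB]] := invS _ (inv_ k); split=> //.
  by rewrite -AE (le_trans AB).
Qed.

End Band.

(** * Facts on the completed Lebesgue measure and on integrals *)

Section LebesgueType.
Context {R : realType}.

Lemma measurable_lebesgue (A : set R) :
  measurable (A : set (measurableTypeR R)) ->
  measurable (A : set (lebesgueType R)).
Proof. exact: sub_caratheodory. Qed.

Lemma leb_segment (a b : R) : a <= b ->
  leb (`[a, b]%classic : set R) = (b - a)%:E.
Proof.
move=> ab; transitivity (lebesgue_measure (`[a, b]%classic : set R)) => //.
by rewrite lebesgue_measure_itv/= lte_fin; case: ltgtP ab => // ->; rewrite subrr.
Qed.

Lemma ae_countable (N : set R) (P : R -> Prop) : countable N ->
  (forall t, ~ N t -> P t) -> {ae @leb R, forall t, P t}.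
Proof.
move=> cN NP; exists N; split.
- apply: measurable_lebesgue; exact: countable_measurable.
- exact: (countable_lebesgue_measure0 cN).
- by move=> t /= nP; apply: contrapT => /NP.
Qed.

End LebesgueType.

(** The integral of a nonnegative function is a supremum over the simple functions below it, hence
    monotone as it stands; the running cost can thus be compared directly with a step function. *)
Lemma ge0_le_integral_nonmeasurable d (T : measurableType d) (R : realType)
    (mu : {measure set T -> \bar R}) (D : set T) (f g : T -> \bar R) :
  (forall x, D x -> (0 <= f x)%E) -> (forall x, D x -> (f x <= g x)%E) ->
  (\int[mu]_(x in D) f x <= \int[mu]_(x in D) g x)%E.
Proof.
move=> f0 fg; rewrite !ge0_integralE//; last first.
  by move=> x Dx; exact: le_trans (f0 _ Dx) (fg _ Dx).
apply: le_ereal_sup => _ [k /= kf <-]; exists k => //= x.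
by apply: (le_trans (kf x)); apply: lee_restrict.
Qed.

(** * Gluing the pieces into one trajectory and one control *)

Section Glue.
Context {R : realType} {n m : nat}.
Context {f : 'rV[R]_n -> 'rV[R]_m -> 'rV[R]_n}.
Context (v : nat -> 'rV[R]_m) (h : nat -> R) (phi : nat -> R -> 'rV[R]_n).
Hypothesis h_gt0 : forall k, 0 < h k.
Hypothesis phi_arc : forall k, control_arc f (v k) (h k) (phi k).
Hypothesis phi_match : forall k, phi k (h k) = phi k.+1 0.
Implicit Types (t s : R) (k : nat).

Definition node k := \sum_(i < k) h i.

(* The default value 0 gives the control the value v 0 after total_time. *)
Definition piece_index t := xget 0%N [set k | node k <= t < node k.+1].

Definition glued t := phi (piece_index t) (t - node (piece_index t)).

Definition glued_control t := v (piece_index t).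

Definition total_time : \bar R := ereal_sup (range (fun k => (node k)%:E)).

Lemma node0 : node 0 = 0.
Proof. by rewrite /node big_ord0. Qed.

Lemma nodeS k : node k.+1 = node k + h k.
Proof. by rewrite /node big_ord_recr. Qed.

Lemma node_lt k : node k < node k.+1.
Proof. by rewrite nodeS ltrDl. Qed.

Lemma node_homo : {homo node : i j / (i <= j)%N >-> i <= j}.
Proof. by apply: homo_leq => //; [exact: le_trans|move=> i; exact/ltW/node_lt]. Qed.

Lemma node_ge0 k : 0 <= node k.
Proof. by rewrite -node0 node_homo. Qed.

Lemma node_lt_total k : ((node k)%:E < total_time)%E.
Proof.
apply: (@lt_le_trans _ _ (node k.+1)%:E); first by rewrite lte_fin node_lt.
by apply: ereal_sup_ubound; exists k.+1.
Qed.

Lemma piece_indexE k t : node k <= t < node k.+1 -> piece_index t = k.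
Proof.
move=> /andP[kt tk]; apply: xget_unique => /=; first by rewrite kt.
move=> j /andP[jt tj]; apply/eqP; rewrite eqn_leq; apply/andP; split;
  rewrite leqNgt; apply/negP => /node_homo.
  by move=> /(lt_le_trans tk)/lt_le_trans/(_ jt); rewrite ltxx.
by move=> /(lt_le_trans tj)/lt_le_trans/(_ kt); rewrite ltxx.
Qed.

Lemma lt_total t : (t%:E < total_time)%E -> exists k, t < node k.
Proof.
by move=> /ereal_sup_gt[_ [k _ <-]]; rewrite lte_fin; exists k.
Qed.

Lemma node_bracket t : 0 <= t -> (t%:E < total_time)%E ->
  exists k, node k <= t < node k.+1.
Proof.
move=> t0 /lt_total[k]; elim: k => [|k IH]; first by rewrite node0 ltNge t0.
by have [kt tk|tk _] := leP (node k) t; [exists k; rewrite kt|exact: IH].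
Qed.

Lemma gluedE k t : node k <= t <= node k.+1 -> glued t = phi k (t - node k).
Proof.
move=> /andP[kt]; rewrite le_eqVlt => /orP[/eqP ->|tk]; last first.
  by rewrite /glued (@piece_indexE k)// kt.
(* At [t = node k.+1] the index is already [k.+1]; [phi_match] reconciles the two pieces. *)
rewrite /glued (@piece_indexE k.+1) ?lexx ?node_lt// subrr -phi_match.
by rewrite nodeS addrAC subrr add0r.
Qed.

(** The constant may grow with [k], but absolute continuity is asked only on compact subintervals of
    the life span, each of which lies in some [[0, node k]]. *)
Lemma glued_lipschitz k : exists M, forall s t, 0 <= s <= node k ->
  0 <= t <= node k -> `|glued s - glued t| <= M * `|s - t|.
Proof.
elim: k => [|k [M1 M1P]].
  exists 0 => s t; rewrite node0 => /le_anti <- /le_anti <-.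
  by rewrite !subrr !normr0 mulr0.
have [_ [M2 M2P]] := phi_arc k.
pose M := Num.max M1 M2.
have P1 s t : 0 <= s <= node k -> 0 <= t <= node k ->
    `|glued s - glued t| <= M * `|s - t|.
  move=> si ti; rewrite (le_trans (M1P _ _ si ti))// ler_wpM2r//.
  by rewrite le_max lexx.
have P2 s t : node k <= s <= node k.+1 -> node k <= t <= node k.+1 ->
    `|glued s - glued t| <= M * `|s - t|.
  move=> si ti; rewrite (gluedE si) (gluedE ti).
  have -> : s - t = (s - node k) - (t - node k) by rewrite opprB subrKA.
  move: si ti; rewrite nodeS => /andP[? ?] /andP[? ?].
  rewrite (le_trans (M2P _ _ _ _))//; [by apply/andP; split; lra..|].
  by rewrite ler_wpM2r// le_max lexx orbT.
exists M => s t; wlog st : s t / s <= t.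
  move=> H si ti; have [st|/ltW ts] := leP s t; first exact: H.
  by rewrite distrC [X in _ * X]distrC H.
move=> /andP[s0 sk] /andP[t0 tk].
have [tk'|/ltW kt] := leP t (node k); first by apply: P1; rewrite ?s0 ?t0// (le_trans st).
have [ks|/ltW sk'] := leP (node k) s; first by apply: P2; rewrite ?ks ?kt.
have h1 := P1 s (node k); have h2 := P2 (node k) t.
rewrite -(subrKA (glued (node k))) (le_trans (ler_normD _ _))//.
rewrite (le_trans (lerD (h1 _ _) (h2 _ _)))//.
- by rewrite s0.
- by rewrite node_ge0 lexx.
- by rewrite lexx ltW// node_lt.
- by rewrite kt.
- rewrite -mulrDr !ler0_norm ?subr_le0//.
  by rewrite !opprB [X in _ * X]addrC subrKA.
Qed.

Lemma is_derive_translate (psi : R -> 'rV[R]_n) (c t : R) w :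
  is_derive (t - c) 1 psi w -> is_derive t 1 (fun s => psi (s - c)) w.
Proof.
have E : (fun e : R => e^-1 *: (psi (e *: 1 + (t - c)) - psi (t - c))) =
    (fun e : R => e^-1 *: (psi (e *: 1 + t - c) - psi (t - c))).
  by apply/funext => e; rewrite addrA.
case=> dpsi <-; apply: DeriveDef.
  by move: dpsi; rewrite /derivable /= E.
by rewrite /derive /= E.
Qed.

Lemma glued_derive k t : node k < t < node k.+1 ->
  is_derive t 1 glued (f (glued t) (glued_control t)).
Proof.
move=> /andP[kt tk].
have -> : glued_control t = v k.
  by rewrite /glued_control (@piece_indexE k)// ltW.
have gt : glued t = phi k (t - node k) by apply: gluedE; rewrite !ltW.
rewrite gt; have [dphi _] := phi_arc k.
have := @is_derive_translate (phi k) (node k) t _ (dphi (t - node k) _).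
move=> H; apply: near_eq_is_derive (H _); last first.
  by rewrite subr_ge0 lerBlDl -nodeS !ltW.
near=> s; apply/esym/gluedE; apply/andP; split; apply/ltW; near: s.
  exact: lt_nbhsr.
exact: lt_nbhsl.
Unshelve. all: by end_near. Qed.

Lemma lipschitz_absolutely_continuous (x : R -> 'rV[R]_n) a b M :
  (forall s t, a <= s <= b -> a <= t <= b -> `|x s - x t| <= M * `|s - t|) ->
  absolutely_continuous a b x.
Proof.
move=> xM e e0; have M1 : 0 < `|M| + 1 by rewrite ltr_wpDl.
exists (e / (`|M| + 1)); first by rewrite divr_gt0.
move=> k s t st _; rewrite ltr_pdivlMr// mulr_suml; apply: le_lt_trans.
apply: ler_sum => i _; have [si [ti tb]] := st i.
rewrite (le_trans (xM _ _ _ _))//; first by rewrite (le_trans si ti).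
  by rewrite si (le_trans ti).
rewrite ger0_norm ?subr_ge0// mulrC ler_wpM2l ?subr_ge0//.
by rewrite (le_trans (ler_norm _))// lerDl.
Qed.

Lemma glued_solution : solution f glued_control (phi 0%N 0) glued total_time.
Proof.
split.
- by rewrite -[0%E]/((0 : R)%:E) -node0; exact: node_lt_total.
- by rewrite (@gluedE 0%N) node0 ?subrr// lexx node_ge0.
- move=> b b0 /lt_total[k bk]; have [M MP] := glued_lipschitz k.
  apply: (@lipschitz_absolutely_continuous _ _ _ M) => s t /andP[s0 sb] /andP[t0 tb].
  by apply: MP; rewrite ?s0 ?t0/= (le_trans _ (ltW bk)).
(* The control may jump at the nodes; these form the countable exceptional set. *)
- apply: (@ae_countable _ (range node)) => [|t Nt t0 tT].
    exact: card_image_le.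
  have [k /andP[kt tk]] := node_bracket (ltW t0) tT.
  apply: (@glued_derive k); rewrite tk andbT lt_neqAle kt andbT.
  by apply/eqP => E; apply: Nt; exists k.
Qed.

Lemma glued_control_measurable : measurable_fun
  (`[0, +oo[%classic : set (lebesgueType R))
  (glued_control : lebesgueType R -> g_sigma_algebraType (@open 'rV[R]_m)).
Proof.
have pos k : (0 < k)%N ->
    piece_index @^-1` [set k] = `[node k, node k.+1[%classic.
  move=> k0; apply/seteqP; split=> t /=; rewrite in_itv/=; last first.
    exact: piece_indexE.
  move=> tk; have : [set k | node k <= t < node k.+1] (piece_index t) .
    apply: xgetPex; apply: contrapT => ne; move: k0; rewrite -tk /piece_index.
    by rewrite xgetPN// => j jP; apply: ne; exists j.
  by rewrite tk.
have mpos k : (0 < k)%N -> measurable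
    (piece_index @^-1` [set k] : set (lebesgueType R)).
  by move=> k0; rewrite pos//; apply: measurable_lebesgue; exact: measurable_itv.
have mk k : measurable (piece_index @^-1` [set k] : set (lebesgueType R)).
  have [->|k0] := eqVneq k 0%N; last by apply: mpos; rewrite lt0n.
  (* Index 0 also collects the negative times and those past [total_time], so its preimage is
     treated as the complement of the others. *)
  rewrite (_ : _ @^-1` _ = ~` (\bigcup_i (piece_index @^-1` [set i.+1]))).
    by apply: measurableC; apply: bigcup_measurable => i _; exact: mpos.
  apply/seteqP; split=> t /=; first by move=> t0 [i _ /=]; rewrite t0.
  by case E : (piece_index t) => [//|i] []; exists i.
move=> mD A _; apply: measurableI => //.
rewrite (_ : _ @^-1` _ = \bigcup_(k in [set k | A (v k)])
    piece_index @^-1` [set k]); first exact: bigcup_measurable.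
apply/seteqP; split=> t /=; first by move=> At; exists (piece_index t).
by move=> [k Ak tk]; rewrite /glued_control tk.
Qed.

Lemma glued_integral_le (g : R -> R) (c : nat -> R) k t :
  node k <= t < node k.+1 ->
  (forall s, 0 <= s <= t -> 0 <= g s <= c (piece_index s)) ->
  (\int[leb]_(s in `[0%R, t]%classic) (g s)%:E <=
   (\sum_(j < k) c j * h j + c k * (t - node k))%:E)%E.
Proof.
move=> /andP[kt tk] gc.
(* [b j] is the right end of piece [j], truncated at [t] for the last one. The closed intervals
   overlap at nodes, which is harmless for an upper bound by nonnegative terms. *)
pose b j := if (j < k)%N then node j.+1 else t.
have bk j : (j < k.+1)%N -> node j <= b j <= t.
  rewrite ltnS leq_eqVlt /b => /orP[/eqP ->|jk]; first by rewrite ltnn kt lexx.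
  by rewrite jk ltW ?node_lt//= (le_trans _ kt)// node_homo.
have c0 j : (j < k.+1)%N -> 0 <= c j.
  move=> jk; have /andP[jb bt] := bk _ jk.
  have := gc (node j); rewrite node_ge0 (le_trans jb bt) (@piece_indexE j).
    by move=> /(_ isT)/andP[]; exact: le_trans.
  by rewrite lexx node_lt.
pose I j : set (lebesgueType R) := `[node j, b j]%classic.
have mI j : measurable (I j).
  by apply: measurable_lebesgue; exact: measurable_itv.
pose G (j : 'I_k.+1) (s : lebesgueType R) : \bar R := ((c j)%:E * (\1_(I j) s)%:E)%E.
have mD : measurable (`[0, t]%classic : set (lebesgueType R)).
  by apply: measurable_lebesgue; exact: measurable_itv.
have G0 j s : (0 <= G j s)%E by rewrite mule_ge0// lee_fin c0.
apply: (@le_trans _ _ (\int[leb]_(s in `[0%R, t]%classic)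
    (\sum_(j <- index_enum 'I_k.+1) G j s))%E).
  apply: ge0_le_integral_nonmeasurable => s /=; rewrite in_itv/= => st.
    by rewrite lee_fin; case/andP: (gc _ st).
  have /andP[s0 st'] := st.
  have [|j /[dup] jI /andP[js sj]] := node_bracket s0.
    by rewrite (le_lt_trans _ (node_lt_total k.+1))// lee_fin (le_trans st')// ltW.
  have jk : (j < k.+1)%N.
    rewrite ltnNge; apply/negP => /node_homo/(lt_le_trans tk)/lt_le_trans/(_ js).
    by rewrite ltNge st'.
  rewrite (bigD1 (Ordinal jk))//=; apply: (@le_trans _ _ (G (Ordinal jk) s)).
    have Is : I j s.
      rewrite /I/= in_itv/= js /b; case: ifP => // _; exact: ltW.
    rewrite /G/= indicE mem_set// mule1 lee_fin.
    by have /andP[_] := gc _ st; rewrite (piece_indexE jI).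
  by rewrite leeDl// sume_ge0.
have mind j : measurable_fun (`[0, t]%classic : set (lebesgueType R))
    (EFin \o (\1_(I j) : lebesgueType R -> R)).
  by apply/measurable_EFinP => /=; exact: measurable_indic (mI j).
rewrite ge0_integral_sum; last 3 first.
- exact: mD.
- by move=> j; exact: measurable_funeM (mind j).
- by move=> j s _; exact: G0.
rewrite (_ : (_ + _)%:E = \sum_(j < k.+1) (c j * (b j - node j))%:E)%E; last first.
  rewrite sumEFin big_ord_recr/= /b ltnn; congr (_ + _)%:E.
  by apply: eq_bigr => j _; rewrite ltn_ord nodeS addrAC subrr add0r.
apply: lee_sum => j _; rewrite ge0_integralZl_EFin; last 4 first.
- exact: mD.
- by move=> s _; rewrite lee_fin.
- exact: mind.
- exact: c0.
have /andP[jb bt] := bk j (ltn_ord j).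
rewrite integral_indic// EFinM lee_wpmul2l ?lee_fin ?c0//.
rewrite -leb_segment//; apply: le_measure; rewrite ?inE//.
- exact: measurableI.
- exact: (mI j).
Qed.

End Glue.

(** * Extension to a maximal solution *)

Lemma rat_between_ereal (R : realType) (t : R) (T : \bar R) : (t%:E < T)%E ->
  exists q : rat, t < ratr q /\ ((ratr q)%:E < T)%E.
Proof.
move=> tT; have [b tb bT] : exists2 b : R, t < b & (b%:E <= T)%E.
  case: T tT => [r|_|//]; first by rewrite lte_fin; exists r.
  by exists (t + 1); [rewrite ltrDl|rewrite leey].
have [q] := rat_in_itvoo tb; rewrite in_itv/= => /andP[tq qb].
by exists q; split=> //; rewrite (lt_le_trans _ bT)// lte_fin.
Qed.

Lemma near_lt_ereal (R : realType) (t : R) (T : \bar R) : (t%:E < T)%E ->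
  \forall s \near t, (s%:E < T)%E.
Proof.
case: T => [r|_|//]; last by near=> s; rewrite ltry.
rewrite lte_fin => tr; near=> s; rewrite lte_fin; near: s; exact: lt_nbhsl.
Unshelve. all: by end_near. Qed.

Section MaximalExtension.
Context {R : realType} {n m : nat}.
Context {f : 'rV[R]_n -> 'rV[R]_m -> 'rV[R]_n} {u : R -> 'rV[R]_m} {z : 'rV[R]_n}.
Implicit Types (x y : R -> 'rV[R]_n) (T : \bar R) (t s : R).

Let trajectory := ((R -> 'rV[R]_n) * \bar R)%type.

Definition extends (b a : trajectory) : Prop := (a.2 <= b.2)%E /\
  forall t, 0 <= t -> (t%:E < a.2)%E -> b.1 t = a.1 t.

Lemma extends_refl a : extends a a.
Proof. by split. Qed.

Lemma extends_trans a b c : extends a b -> extends b c -> extends a c.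
Proof.
move=> [ab abE] [bc bcE]; split; first exact: le_trans ab.
by move=> t t0 tc; rewrite abE// ?bcE// (lt_le_trans tc).
Qed.

Lemma absolutely_continuous_eq (V : normedModType R) a b (x y : R -> V) :
  (forall t, a <= t <= b -> x t = y t) ->
  absolutely_continuous a b x -> absolutely_continuous a b y.
Proof.
move=> xy xac e /xac[d d0 dP]; exists d => // k s t st tr lt_d.
apply: le_lt_trans (dP _ _ _ st tr lt_d); apply: ler_sum => i _.
have [si [sti ti]] := st i.
by rewrite !xy ?si ?ti ?(le_trans si sti) ?(le_trans sti ti).
Qed.

(** A chain may be uncountable, and uncountably many null sets cannot be united. Members selected at
    rational times suffice: every time before the supremum is followed by a rational that some
    member outlives. *)
Lemma chain_union_solution (A : set trajectory) : A !=set0 ->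
  (forall a, A a -> solution f u z a.1 a.2) ->
  (forall a b, A a -> A b -> extends a b \/ extends b a) ->
  exists2 b : trajectory, solution f u z b.1 b.2 & forall a, A a -> extends b a.
Proof.
move=> [a0 Aa0] solA totA.
(* [g t] is a member of the chain that lives past [t], if there is one, and any member otherwise. *)
have /choice[g gP] t : exists a, A a /\
    ((exists2 b, A b & (t%:E < b.2)%E) -> (t%:E < a.2)%E).
  have [[b Ab tb]|nb] := pselect (exists2 b, A b & (t%:E < b.2)%E).
    by exists b.
  by exists a0.
pose X t := (g t).1 t; pose S := ereal_sup [set a.2 | a in A].
have XE a t : A a -> 0 <= t -> (t%:E < a.2)%E -> X t = a.1 t.
  move=> Aa t0 ta; have [Agt /(_ _)/wrap[]] := gP t; first by exists a.
  move=> tg; have [[_ E]|[_ E]] := totA _ _ Agt Aa; first by rewrite /X E.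
  by rewrite /X -E.
have extA a : A a -> extends (X, S) a.
  move=> Aa; split; first by apply: ereal_sup_ubound; exists a.
  by move=> t t0 ta; exact: XE.
exists (X, S) => //; split => /=.
- by have [a00 _ _ _] := solA _ Aa0; rewrite (lt_le_trans a00)//; case: (extA _ Aa0).
- by have [a00 <- _ _] := solA _ Aa0; apply: XE.
- move=> b b0 /ereal_sup_gt[_ [a Aa <-] ba].
  have [_ _ /(_ b b0 ba) + _] := solA _ Aa; apply: absolutely_continuous_eq.
  move=> t /andP[t0 tb]; rewrite (XE a)//.
  by rewrite (le_lt_trans _ ba)// lee_fin.
- pose G (k : nat) := g (ratr (odflt 0 (unpickle k : option rat))).
  have : {ae @leb R, forall t k, 0 < t -> (t%:E < (G k).2)%E ->
      is_derive t 1 (G k).1 (f ((G k).1 t) (u t))}.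
    apply: ae_foralln => k; have [AG _] := gP (ratr (odflt 0 (unpickle k : option rat))).
    by have [_ _ _] := solA _ AG.
  move=> [N [mN N0 NP]]; exists N; split=> // t /= nt; apply: NP => /= tP.
  apply: nt => t0 /ereal_sup_gt[_ [a Aa <-] ta].
  have [q [tq qa]] := rat_between_ereal ta.
  have [AG] := gP (ratr q); move=> /(_ (ex_intro2 _ _ a Aa qa)) qG.
  have tG : (t%:E < (g (ratr q)).2)%E by rewrite (lt_trans _ qG)// lte_fin.
  have := tP (pickle q); rewrite /G pickleK/= => /(_ t0 tG) dG.
  rewrite (XE (g (ratr q)))// ?(ltW t0)//; apply: near_eq_is_derive dG.
  near=> s; apply/esym/XE => //; near: s; last exact: near_lt_ereal.
  by near=> s; apply/ltW; near: s; exact: lt_nbhsr.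
Unshelve. all: by end_near. Qed.

(** Zorn's lemma for the preorder of extension. A maximal element is extended by a competitor only
    if it extends that competitor in turn, so their life spans agree. *)
Lemma maximal_extension x T : solution f u z x T ->
  exists y Tmax, [/\ maximal_solution f u z y Tmax, (T <= Tmax)%E &
    forall t, 0 <= t -> (t%:E < T)%E -> y t = x t].
Proof.
move=> xT; pose P (a : trajectory) := solution f u z a.1 a.2 /\ extends a (x, T).
pose r (a b : {a | P a}) : bool := `[< extends (sval b) (sval a) >].
have [] := @ZL_preorder {a | P a} (exist _ (x, T) (conj xT (extends_refl _))) r.
- by move=> a; apply/asboolP; exact: extends_refl.
- move=> a b c /asboolP ab /asboolP bc; apply/asboolP; exact: extends_trans bc ab.
- move=> A totA; have [[a Aa]|nA] := pselect (A !=set0); last first.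
    exists (exist _ (x, T) (conj xT (extends_refl _))) => s As.
    by exfalso; apply: nA; exists s.
  have [|_ [b Ab <-]||b solb bP] := @chain_union_solution [set sval a | a in A].
  + by exists (sval a), a.
  + by case: (svalP b).
  + move=> _ _ [b Ab <-] [c Ac <-]; have [/asboolP|/asboolP] := totA b c Ab Ac.
      by right.
    by left.
  + have Pb : P b.
      split=> //; apply: (@extends_trans _ (sval a)); last by case: (svalP a).
      by apply: bP; exists a.
    by exists (exist _ b Pb) => s As; apply/asboolP/bP; exists s.
move=> [[y Tmax] [/= soly [TT yx]]] ymax; exists y, Tmax; split=> //.
split=> // y' T' soly' TT' yy'; apply/le_anti/andP; split=> //.
have e' : extends (y', T') (y, Tmax) by split.
have P' : P (y', T').
  split=> //; apply: extends_trans e' _; split=> //.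
by have /asboolP[] := ymax (exist _ (y', T') P') (asboolT e').
Qed.

End MaximalExtension.

(** If [w] were never halved after [k], it would stay constant, the same step [h (w k)] would recur
    forever, and the total length would exceed [tau]. *)
Lemma halving_sequence (R : realType) (w : nat -> R) (h : R -> R) (tau : R) :
  (forall k, 0 < w k) -> (forall k, 0 < h (w k)) ->
  (forall k, w k.+1 = w k \/ w k.+1 <= w k / 2) ->
  (forall k, \sum_(i < k) h (w i) <= tau) ->
  forall e, 0 < e -> exists k, forall j, (k <= j)%N -> w j <= e.
Proof.
move=> w0 h0 wS hT e e0.
have wle k : w k.+1 <= w k.
  by have [->//|] := wS k; have := w0 k; lra.
have wn : {homo w : i j / (i <= j)%N >-> j <= i}.
  by apply: homo_leq => // x y z ? /le_trans; exact.
have half k : exists j, w j <= w k / 2.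
  apply: contrapT => /forallNP nj.
  have wE i : w (k + i)%N = w k.
    elim: i => [|i IH]; first by rewrite addn0.
    by rewrite addnS; have [->//|] := wS (k + i)%N; rewrite IH -addnS => /nj.
  have hE i : h (w k) *+ i <= \sum_(j < k + i) h (w j).
    elim: i => [|i IH]; first by rewrite mulr0n sumr_ge0// => j _; exact: ltW.
    by rewrite addnS big_ord_recr/= mulrSr wE lerD.
  pose i := Num.bound `|tau / h (w k)|.
  have : tau < h (w k) *+ i.
    rewrite -mulr_natr mulrC -ltr_pdivrMr// /i.
    exact: le_lt_trans (ler_norm _) (archi_boundP (normr_ge0 _)).
  by rewrite ltNge (le_trans (hE i)).
have pow N : exists j, w j <= w 0%N / 2 ^+ N.
  elim: N => [|N [j jN]]; first by exists 0%N; rewrite expr0 divr1.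
  have [j' jj'] := half j; exists j'; rewrite (le_trans jj')//.
  by rewrite exprSr invfM mulrA ler_wpM2r.
have [N Ne] := geometric_lt (w 0%N) e0; have [k kN] := pow N.
by exists k => j /wn/le_trans; apply; rewrite (le_trans kN)// ltW.
Qed.

(** * Small values of [W] force a small distance from the target *)

Section Distance.
Context {R : realType} {n : nat}.
Implicit Types (C : set 'rV[R]_n) (x y : 'rV[R]_n).

Lemma edistance_ge0 C y : C !=set0 -> 0 <= edistance C y.
Proof.
move=> [c Cc]; apply: lb_le_inf; first by exists (enorm (y - c)), c.
by move=> _ [a _ <-]; exact: sqrtr_ge0.
Qed.

Lemma edistance_le C y c : C c -> edistance C y <= enorm (y - c).
Proof.
move=> Cc; apply: ge_inf; last by exists c.
by exists 0 => _ [a _ <-]; exact: sqrtr_ge0.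
Qed.

Lemma enorm_le x : enorm x <= n.+1%:R * `|x|.
Proof.
rewrite -(@ler_pXn2r _ 2)// ?nnegrE ?sqrtr_ge0 ?mulr_ge0// enorm_sq.
rewrite (le_trans (dotv_le _ _))// exprMn expr2 -mulrA ler_pM ?ler_nat//.
by rewrite expr2 ler_peMl ?mulr_ge0// ler1n.
Qed.

(** On the compact sublevel set [W <= 1] the claim is local. Near a point of [C] the distance itself
    is small; near a point [a] off [C], [W] stays above [W a / 2], so no point there satisfies
    [W b <= s] for small [s]. *)
Lemma edistance_cvg0 C (W : 'rV[R]_n -> R) e :
  {within closure (~` C), continuous W} -> positive_definite C W ->
  proper_on_domain C W -> 0 < e ->
  exists2 s, 0 < s & forall b, ~ C b -> W b <= s -> edistance C b < e.
Proof.
move=> cW [W0 _] Wp e0.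
pose K := closure (~` C) `&` W @^-1` `[0, 1].
have cK : compact K.
  apply: Wp; first exact: segment_compact.
  by move=> s /=; rewrite !in_itv/= andbT => /andP[].
pose P s b := ~ C b -> W b <= s -> edistance C b < e.
have [a [Da _]|s s0 sP] := compact_radius (P := P) cK; last first.
  exists (Num.min s 1) => [|b Cb]; first by rewrite lt_min s0 ltr01.
  rewrite le_min => /andP[bs b1]; apply: sP => //; split.
    exact: subset_closure.
  by rewrite /= in_itv/= b1 ltW// W0.
have [Ca|Ca] := pselect (C a).
  exists (e / n.+1%:R); first by rewrite divr_gt0.
  move=> b s ba _ _ _; rewrite (le_lt_trans (edistance_le _ Ca))//.
  by rewrite (le_lt_trans (enorm_le _))// mulrC -ltr_pdivlMr.
have Wa := W0 _ Ca; have Wa2 : 0 < W a / 2 by rewrite divr_gt0.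
have [d d0 dP] := within_continuousP cW Da Wa2.
exists (Num.min d (W a / 2)); first by rewrite lt_min d0.
move=> b s; rewrite lt_min le_min => /andP[bd _] /andP[s0 /andP[sd sW]] Cb Wb.
have := dP b (@subset_closure _ _ _ Cb) bd.
by rewrite ltr_norml => /andP[? ?]; lra.
Qed.

End Distance.

(** * The bound on the value: one admissible control of cost at most [W z + e] *)

Theorem proposition4p1 (R : realType) (n m : nat)
    (U : set 'rV[R]_m) (C : set 'rV[R]_n)
    (f : 'rV[R]_n -> 'rV[R]_m -> 'rV[R]_n)
    (l : 'rV[R]_n -> 'rV[R]_m -> R)
    (p0 gamma : R -> R) (W : 'rV[R]_n -> R)
    (U_nonempty : U !=set0) (U_compact : compact U)
    (C_nonempty : C !=set0) (C_closed : closed C)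
    (bdC_compact : compact (boundary C))
    (f_cont : {within [set: 'rV[R]_n] `*` U,
                 continuous (fun xu => f xu.1 xu.2)})
    (l_cont : {within [set: 'rV[R]_n] `*` U,
                 continuous (fun xu => l xu.1 xu.2)})
    (l_ge0 : forall x u, U u -> 0 <= l x u)
    (f_lip : locally_lipschitz_unif U f)
    (l_lip : locally_lipschitz_unif U l)
    (p0_cont : {within `]0, +oo[, continuous p0})
    (p0_incr : {in `]0, +oo[ &, {homo p0 : s t / s <= t}})
    (p0_range : forall s : R, 0 < s -> 0 <= p0 s <= 1)
    (gamma_cont : {within `]0, +oo[, continuous gamma})
    (gamma_incr : {in `]0, +oo[ &, {homo gamma : s t / s < t}})
    (gamma_gt0 : forall s : R, 0 < s -> 0 < gamma s)
    (W_mrf : minimum_restraint_function C U f l p0 gamma W) :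
  forall z : 'rV[R]_n, ~ C z ->
    (ereal_inf [set J : \bar R |
       exists (u : R -> 'rV[R]_m) (x : R -> 'rV[R]_n) (Tz : \bar R),
         admissible C U f z u x Tz /\
         J = ereal_sup [set running_value l p0 gamma W x u T |
                          T in [set T : R | (0 <= T)%R /\ (T%:E < Tz)%E]]]
     <= (W z)%:E)%E.
Proof.
move=> z Cz; have [W_ge0 cW posW propW decr] := W_mrf.
apply/lee_addgt0Pr => e e0.
have [v [phi [c [w [h [phi0 piece wS phiP]]]]]] :=
  piece_sequence U_compact C_closed f_cont l_cont l_ge0 f_lip l_lip p0_cont
    p0_range gamma_cont gamma_incr gamma_gt0 W_mrf Cz e0.
pose H k := h (w k).
have H0 k : 0 < H k by case: (piece k).
have arcP k : control_arc f (v k) (H k) (phi k) by case: (piece k).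
have matchP k : phi k (H k) = phi k.+1 0 by case: (piece k).
have w0 k : 0 < w k by case: (piece k).
pose u := glued_control v H; pose T := total_time H.
have gsol : solution f u z (glued H phi) T.
  by rewrite -phi0; exact: glued_solution.
(* The trajectory of the statement is the maximal [x], which may live beyond [T]; the time [T_z(u)]
   is nevertheless [T], before which [x] agrees with the glued arc. *)
have [x [Tmax [xmax TTmax xE]]] := maximal_extension gsol.
have xphi k t : node H k <= t < node H k.+1 -> x t = phi k (t - node H k).
  move=> /andP[kt tk]; rewrite xE ?(le_trans (node_ge0 H0 k))//.
    by apply: gluedE => //; rewrite kt ltW.
  by rewrite (lt_trans _ (node_lt_total H0 k.+1))// lte_fin.
have inI k t : node H k <= t < node H k.+1 -> 0 <= t - node H k <= H k.
  by rewrite nodeS => /andP[? ?]; apply/andP; split; lra.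
have uE k t : node H k <= t < node H k.+1 -> u t = v k.
  by move=> kt; rewrite /u /glued_control (piece_indexE H0 kt).
have Uu t : U (u t) by rewrite /u /glued_control; case: (piece (piece_index H t)).
have notC t : 0 <= t -> (t%:E < T)%E -> ~ C (x t).
  move=> t0 /(node_bracket t0)[k kt]; rewrite (xphi _ _ kt).
  by have [] := phiP k _ (inI _ _ kt).
have target tau : T = tau%:E -> edistance C (x t) @[t --> tau^'-] --> (0 : R).
  move=> Ttau; apply/cvgrPdist_lt => d d0.
  have [s s0 sd] := edistance_cvg0 cW posW propW d0.
  (* The third compensates for the bound [W <= 3 * w k] along a piece. *)
  have s3 : 0 < s / 3 by rewrite divr_gt0.
  have [|k kw] := halving_sequence w0 H0 wS _ s3 (tau := tau).
    by move=> k; rewrite -lee_fin -Ttau; apply/ltW; exact: node_lt_total.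
  have ktau : node H k < tau by rewrite -lte_fin -Ttau; exact: node_lt_total.
  near=> t; rewrite sub0r normrN ger0_norm ?edistance_ge0//.
  have tT : (t%:E < T)%E by rewrite Ttau lte_fin; near: t; exact: nbhs_left_lt.
  have kt : node H k <= t by near: t; apply: nbhs_left_ge.
  have t0 : 0 <= t by rewrite (le_trans (node_ge0 H0 k)).
  apply: sd; first exact: notC.
  have [j /[dup] jt /andP[jt1 jt2]] := node_bracket t0 tT.
  have kj : (k <= j)%N.
    rewrite leqNgt; apply/negP => jk.
    have := node_homo H0 jk; have := lt_le_trans (le_lt_trans kt jt2).
    by move=> /[apply]; rewrite ltxx.
  rewrite (xphi _ _ jt); have [_ + _ _] := phiP j _ (inI _ _ jt).
  by have := kw j kj; lra.
apply: (@le_trans _ _ (ereal_sup [set running_value l p0 gamma W x u t |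
    t in [set t : R | (0 <= t)%R /\ (t%:E < T)%E]])).
  apply: ereal_inf_lbound; exists u, x, T; split=> //; split.
    by split; [move=> t _; exact: Uu|exact: glued_control_measurable].
  exists Tmax => //; split=> //.
  by case: gsol.
apply: ge_ereal_sup => _ [t [t0 tT] <-].
have [k kt] := node_bracket t0 tT.
have tk := inI _ _ kt; have [_ _ ck AW] := phiP k _ tk.
pose g s := p0 (W (x s)) * l (x s) (u s) + gamma (W (x s)).
have gP s : 0 <= s <= t -> 0 <= g s <= c (piece_index H s).
  move=> /andP[s0 st].
  have sT : (s%:E < T)%E by rewrite (le_lt_trans _ tT)// lee_fin.
  have Wxs : 0 < W (x s) by apply: posW.1; exact: notC.
  apply/andP; split.
    rewrite addr_ge0 ?(ltW (gamma_gt0 _ _))// mulr_ge0 ?l_ge0//.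
    by case/andP: (p0_range _ Wxs).
  have [j js] := node_bracket s0 sT.
  rewrite (piece_indexE H0 js) /g (uE _ _ js) (xphi _ _ js).
  by have [] := phiP j _ (inI _ _ js).
have c0 : 0 <= c k.
  have := gP t; rewrite t0 lexx (piece_indexE H0 kt) => /(_ isT)/andP[].
  exact: le_trans.
(* Up to [t] the current piece costs at most [c k * (t - node H k)], which is no more than the full
   charge [c k * H k] already included in the bound on the pieces. *)
rewrite /running_value (@le_trans _ _ ((\sum_(j < k) c j * H j +
  c k * (t - node H k))%:E + (W (x t))%:E)%E)//.
  by rewrite leeD2r//; exact: glued_integral_le.
rewrite -EFinD lee_fin (xphi _ _ kt) (le_trans _ AW)// lerD2r.
rewrite big_ord_recr/= lerD2l ler_wpM2l//.
by case/andP: tk.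
Unshelve. all: by end_near. Qed.
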